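(* Let $\mathscr{E}$ be a category with pullbacks and let $G$ be a comonad on $\mathscr{E}$ (with comultiplication $\delta$ and counit $\varepsilon$) which preserves pullbacks. Let $\mathscr{G}$ be the comonad on $\mathrm{Spn}(\mathscr{E})$ in $\mathrm{Caten}$ whose objects are the $G$-coalgebras $(A,\gamma:A\to GA)$, with $(A,\gamma)_0=A$, and whose hom endofunctors are $$\mathscr{G}_{(A,\gamma)}^{(A',\gamma')}(u,S,v)=\gamma'^{*}\otimes(Gu,GS,Gv)\otimes\gamma_{*},$$ with the remaining structure specified in the context. Then there is an equivalence $$\mathrm{Spn}(\mathscr{E})^{\mathscr{G}}\simeq\mathrm{Spn}(\mathscr{E}^{G})$$ in $\mathrm{Caten}$, where $\mathscr{E}^G$ is the category of Eilenberg–Moore $G$-coalgebras.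
   Context: Spans. For $\mathscr E$ with pullbacks, $\mathrm{Spn}(\mathscr E)$ is the bicategory with objects those of $\mathscr E$, morphisms $(u,S,v):A\to A'$ the spans $A\xleftarrow{u}S\xrightarrow{v}A'$, and 2-cells $(u,S,v)\Rightarrow(r,T,s)$ the morphisms $f:S\to T$ with $rf=u$, $sf=v$. Composition is $(u',S',v')\otimes(u,S,v)=(up,P,v'q)$ where $(p,q)$ is the pullback of $S\xrightarrow{v}A'\xleftarrow{u'}S'$; the identity of $A$ is $(1_A,A,1_A)$. For $h:A\to B$ in $\mathscr E$, $h_*=(1_A,A,h):A\to B$ and $h^*=(h,A,1_A):B\to A$, with $h_*\dashv h^*$. Caten. Write $\mathscr V_V^{V'}=\mathscr V(V,V')$ for hom categories and $\otimes$ for horizontal composition in a bicategory; coherence isomorphisms are suppressed. $\mathrm{Caten}$ is the tricategory whose objects are bicategories and whose morphisms $\mathscr A:\mathscr W\to\mathscr V$ (2-sided enriched categories) consist of a set $\mathrm{Ob}\mathscr A$ with functions $(-)_-$ to $\mathrm{Ob}\mathscr W$ and $(-)_+$ to $\mathrm{Ob}\mathscr V$, functors $\mathscr A_A^{A'}:\mathscr W_{A_-}^{A'_-}\to\mathscr V_{A_+}^{A'_+}$, 2-cells $\eta_A:1_{A_+}\to\mathscr A_A^A(1_{A_-})$ and natural 2-cells $\mu:\mathscr A_{A'}^{A''}(w')\otimes\mathscr A_A^{A'}(w)\to\mathscr A_A^{A''}(w'\otimes w)$ satisfying unit and associativity laws; composition composes spans of objects by pullback and composes the hom functors. 2-cells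 $F:\mathscr A\to\mathscr B$ (enriched functors) are functions on objects with $(FA)_\pm=A_\pm$ and natural transformations $\mathscr A_A^{A'}\Rightarrow\mathscr B_{FA}^{FA'}$ compatible with $\mu,\eta$. 3-cells $\psi:F\to E$ are families $\psi_A:1_{A_+}\to\mathscr B_{FA}^{EA}(1_{A_-})$ with $\mu(\psi_{A'}\otimes(F_A^{A'})_w)=\mu((E_A^{A'})_w\otimes\psi_A)$. Pseudofunctors are particular morphisms (with $\mathrm{Ob}\mathscr A=\mathrm{Ob}\mathscr W$). Comonads in Caten. A comonad $\mathscr G$ on $\mathscr V$ in $\mathrm{Caten}$ amounts to a set $\mathrm{Ob}\mathscr G$ with a function $G\mapsto G_0\in\mathrm{Ob}\mathscr V$, endofunctors $\mathscr G_G^{G'}$ of $\mathscr V_{G_0}^{G'_0}$, and natural 2-cells $\mu_{v',v}:\mathscr G_{G'}^{G''}(v')\otimes\mathscr G_G^{G'}(v)\to\mathscr G_G^{G''}(v'\otimes v)$, $\eta_G:1_{G_0}\to\mathscr G_G^G(1_{G_0})$, $\mathrm d_v:\mathscr G_G^{G'}v\to\mathscr G_G^{G'}\mathscr G_G^{G'}v$, $\mathrm e_v:\mathscr G_G^{G'}v\to v$ such that $(\mu,\eta)$ is associative and unital, each $(\mathscr G_G^{G'},\mathrm e,\mathrm d)$ is a comonad, and $\mathrm e,\mathrm d$ are compatible with $\mu,\eta$ (they are enriched functors $\mathscr G\to1_{\mathscr V}$, $\mathscr G\to\mathscr G\circ\mathscr G$). The bicategory $\mathscr V^{\mathscr G}$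 has objects $\mathrm{Ob}\mathscr G$ and homs $\mathscr V^{\mathscr G}(G,G')$ the Eilenberg–Moore coalgebras $(v,\gamma_v)$ for $\mathscr G_G^{G'}$ on $\mathscr V_{G_0}^{G'_0}$; identities are $(1_{G_0},\eta_G)$ and $(v',\gamma_{v'})\otimes(v,\gamma_v)=(v'\otimes v,\mu_{v',v}(\gamma_{v'}\otimes\gamma_v))$. The comonad $\mathscr G$ on $\mathrm{Spn}(\mathscr E)$. Since coactions $\gamma:A\to GA$ are monomorphisms, the identity span of $A$ is a pullback of $\gamma$ along itself, giving a unique invertible 2-cell $\eta_{(A,\gamma)}:1_A\Rightarrow\mathscr G_{(A,\gamma)}^{(A,\gamma)}1_A$. The composition $\mu$ is the 2-cell $\gamma''^*\otimes(Gu',GS',Gv')\otimes\gamma'_*\otimes\gamma'^*\otimes(Gu,GS,Gv)\otimes\gamma_*\Rightarrow\gamma''^*\otimes(Gu',GS',Gv')\otimes(Gu,GS,Gv)\otimes\gamma_*\cong\gamma''^*\otimes G\big((u',S',v')\otimes(u,S,v)\big)\otimes\gamma_*$ given by the counit of $\gamma'_*\dashv\gamma'^*$ and preservation of pullbacks by $G$ (here $G$ is applied to spans componentwise). The object $\mathscr G(u,S,v)$ is the limit of $A\xrightarrow{\gamma}GA\xleftarrow{Gu}GS\xrightarrow{Gv}GA'\xleftarrow{\gamma'}A'$, and $\mathscr G^2(u,S,v)$ is the limit of $A\xrightarrow{G\gamma\circ\gamma}G^2A\xleftarrow{G^2u}G^2S\xrightarrow{G^2v}G^2A'\xleftarrow{G\gamma'\circ\gamma'}A'$.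 The component of $\mathrm d$ is induced on these limits by $1_A,\delta_A,\delta_S,\delta_{A'},1_{A'}$, and the component of $\mathrm e$ is induced by $1_A,\varepsilon_A,\varepsilon_S,\varepsilon_{A'},1_{A'}$ into the limit $S$ of $A\xrightarrow{1}A\xleftarrow{u}S\xrightarrow{v}A'\xleftarrow{1}A'$. *)

(* Defs.v *)
From Corelib Require Import ssreflect.
From Stdlib Require Import ProofIrrelevance.

Set Implicit Arguments.
Unset Strict Implicit.
Unset Printing Implicit Defensive.

Record Category := {
  ob :> Type;
  hom : ob -> ob -> Type;
  idm : forall a, hom a a;
  comp : forall a b c, hom b c -> hom a b -> hom a c;
  comp_idl : forall a b (f : hom a b), comp (idm b) f = f;
  comp_idr : forall a b (f : hom a b), comp f (idm a) = f;
  comp_assoc : forall a b c d (h : hom c d) (g : hom b c) (f : hom a b),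
    comp (comp h g) f = comp h (comp g f) }.
Arguments hom {_} _ _.
Arguments idm {_} a.
Arguments comp {_ _ _ _} _ _.

Declare Scope cat_scope.
Open Scope cat_scope.
Notation "g ∘ f" := (comp g f) (at level 41, right associativity) : cat_scope.

Record Functor (C D : Category) := {
  fob :> C -> D;
  fmap : forall a b, hom a b -> hom (fob a) (fob b);
  fmap_id : forall a, fmap (idm a) = idm (fob a);
  fmap_comp : forall a b c (g : hom b c) (f : hom a b),
    fmap (g ∘ f) = fmap g ∘ fmap f }.
Arguments fmap {C D} _ {a b} _.

Definition IdFunctor (C : Category) : Functor C C :=
  {| fob := fun a => a; fmap := fun _ _ f => f;
     fmap_id := fun _ => eq_refl; fmap_comp := fun _ _ _ _ _ => eq_refl |}.

Definition CompFunctor (C D F : Category) (K : Functor D F) (H : Functor C D) :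
  Functor C F.
Proof.
refine {| fob := fun a => K (H a); fmap := fun _ _ f => fmap K (fmap H f) |}.
- by move=> a; rewrite !fmap_id.
- by move=> a b c g f; rewrite !fmap_comp.
Defined.

(** The universal property is carried as data; it is a subsingleton
    (the lift is determined), so nothing is being chosen. *)
Record IsPullback (E : Category) (a b c p : E) (f : hom a c) (g : hom b c)
    (pl : hom p a) (pr : hom p b) := {
  pbk_comm : f ∘ pl = g ∘ pr;
  pbk_lift : forall x (h : hom x a) (k : hom x b), f ∘ h = g ∘ k -> hom x p;
  pbk_liftl : forall x (h : hom x a) (k : hom x b) (e : f ∘ h = g ∘ k),
    pl ∘ pbk_lift e = h;
  pbk_liftr : forall x (h : hom x a) (k : hom x b) (e : f ∘ h = g ∘ k),
    pr ∘ pbk_lift e = k;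
  pbk_uniq : forall x (h k : hom x p),
    pl ∘ h = pl ∘ k -> pr ∘ h = pr ∘ k -> h = k }.

Record Pullback (E : Category) (a b c : E) (f : hom a c) (g : hom b c) := {
  pb :> E;
  pbl : hom pb a;
  pbr : hom pb b;
  pb_is : IsPullback f g pbl pbr }.
Arguments pbl {E a b c f g} _.
Arguments pbr {E a b c f g} _.

Definition HasPullbacks (E : Category) :=
  forall (a b c : E) (f : hom a c) (g : hom b c), Pullback f g.

Definition PreservesPullbacks (E D : Category) (F : Functor E D) :=
  forall (a b c p : E) (f : hom a c) (g : hom b c)
         (pl : hom p a) (pr : hom p b),
    IsPullback f g pl pr ->
    IsPullback (fmap F f) (fmap F g) (fmap F pl) (fmap F pr).

Section PullbackTheory.
Variables (E : Category) (a b c : E) (f : hom a c) (g : hom b c).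
Variable P : Pullback f g.

Lemma pb_comm : f ∘ pbl P = g ∘ pbr P.
Proof. exact: pbk_comm (pb_is P). Qed.

Definition pb_lift x (h : hom x a) (k : hom x b) (e : f ∘ h = g ∘ k) :
  hom x P := pbk_lift (pb_is P) e.

Lemma pbl_lift x (h : hom x a) (k : hom x b) (e : f ∘ h = g ∘ k) :
  pbl P ∘ pb_lift e = h.
Proof. exact: pbk_liftl. Qed.

Lemma pbr_lift x (h : hom x a) (k : hom x b) (e : f ∘ h = g ∘ k) :
  pbr P ∘ pb_lift e = k.
Proof. exact: pbk_liftr. Qed.

Lemma pbl_liftA x y (h : hom x a) (k : hom x b) (e : f ∘ h = g ∘ k)
  (z : hom y x) : pbl P ∘ pb_lift e ∘ z = h ∘ z.
Proof. by rewrite -comp_assoc pbl_lift. Qed.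

Lemma pbr_liftA x y (h : hom x a) (k : hom x b) (e : f ∘ h = g ∘ k)
  (z : hom y x) : pbr P ∘ pb_lift e ∘ z = k ∘ z.
Proof. by rewrite -comp_assoc pbr_lift. Qed.

Lemma pb_eq x (h k : hom x P) :
  pbl P ∘ h = pbl P ∘ k -> pbr P ∘ h = pbr P ∘ k -> h = k.
Proof. exact: pbk_uniq (pb_is P) _ _ _. Qed.
End PullbackTheory.

Definition Mono (E : Category) (a b : E) (m : hom a b) :=
  forall x (h k : hom x a), m ∘ h = m ∘ k -> h = k.

Lemma preserves_mono (E D : Category) (F : Functor E D) :
  PreservesPullbacks F ->
  forall (a b : E) (m : hom a b), Mono m -> Mono (fmap F m).
Proof.
move=> HF a b m mm x h k e.
have P : IsPullback m m (idm a) (idm a).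
{ refine {| pbk_lift := fun x h k _ => h |} => //.
  - by move=> *; rewrite comp_idl.
  - by move=> y u v /mm ->; rewrite comp_idl.
  - by move=> y u v; rewrite !comp_idl. }
have Q := HF _ _ _ _ _ _ _ _ P.
by rewrite -(pbk_liftl Q e) -[RHS](pbk_liftr Q e).
Qed.

Record Comonad (C : Category) := {
  cm_functor :> Functor C C;
  delta : forall x, hom (cm_functor x) (cm_functor (cm_functor x));
  eps : forall x, hom (cm_functor x) x;
  delta_nat : forall x y (f : hom x y),
    delta y ∘ fmap cm_functor f = fmap cm_functor (fmap cm_functor f) ∘ delta x;
  eps_nat : forall x y (f : hom x y),
    eps y ∘ fmap cm_functor f = f ∘ eps x;
  eps_delta : forall x, eps (cm_functor x) ∘ delta x = idm _;
  feps_delta : forall x, fmap cm_functor (eps x) ∘ delta x = idm _;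
  delta_delta : forall x,
    delta (cm_functor x) ∘ delta x = fmap cm_functor (delta x) ∘ delta x }.
Arguments delta {C} _ x.
Arguments eps {C} _ x.

Record Coalgebra (C : Category) (G : Comonad C) := {
  carrier :> C;
  coact : hom carrier (G carrier);
  coact_eps : eps G carrier ∘ coact = idm carrier;
  coact_delta : delta G carrier ∘ coact = fmap G coact ∘ coact }.
Arguments coact {C G} _.

Record CoalgebraHom (C : Category) (G : Comonad C) (X Y : Coalgebra G) := {
  cohom :> hom X Y;
  cohomP : coact Y ∘ cohom = fmap G cohom ∘ coact X }.

Lemma cohom_eq (C : Category) (G : Comonad C) (X Y : Coalgebra G)
  (f g : CoalgebraHom X Y) : cohom f = cohom g -> f = g.
Proof.
case: f g => [f pf] [g pg] /= e; subst g.
by rewrite (proof_irrelevance _ pf pg).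
Qed.

Definition EM (C : Category) (G : Comonad C) : Category.
Proof.
unshelve refine {| ob := Coalgebra G; hom := @CoalgebraHom C G;
  idm := fun X => {| cohom := idm (carrier X) |};
  comp := fun X Y Z g f => {| cohom := cohom g ∘ cohom f |} |}.
- by rewrite fmap_id comp_idl comp_idr.
- by rewrite fmap_comp -comp_assoc cohomP comp_assoc cohomP -comp_assoc.
- by move=> X Y f; apply: cohom_eq; rewrite /= comp_idl.
- by move=> X Y f; apply: cohom_eq; rewrite /= comp_idr.
- by move=> X Y Z W h g f; apply: cohom_eq; rewrite /= comp_assoc.
Defined.

(** Pullbacks of coalgebras, created by the forgetful functor. *)
Section EMPullbacks.
Variables (E : Category) (PB : HasPullbacks E) (G : Comonad E).
Variable HG : PreservesPullbacks G.
Variables (X Y Z : EM G) (f : hom X Z) (g : hom Y Z).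

Let P := PB (cohom f) (cohom g).
Let GP := HG (pb_is P).

Lemma em_pb_act_subproof :
  fmap G (cohom f) ∘ (coact X ∘ pbl P) = fmap G (cohom g) ∘ (coact Y ∘ pbr P).
Proof. by rewrite -!comp_assoc -!cohomP !comp_assoc pb_comm. Qed.

Definition em_pb_act : hom (pb P) (G P) := pbk_lift GP em_pb_act_subproof.

Lemma em_pb_actl : fmap G (pbl P) ∘ em_pb_act = coact X ∘ pbl P.
Proof. exact: pbk_liftl. Qed.

Lemma em_pb_actr : fmap G (pbr P) ∘ em_pb_act = coact Y ∘ pbr P.
Proof. exact: pbk_liftr. Qed.

Definition em_pb_ob : Coalgebra G.
Proof.
refine {| carrier := pb P; coact := em_pb_act |}.
- apply: pb_eq; rewrite -comp_assoc -eps_nat comp_assoc ?em_pb_actl ?em_pb_actr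
    -comp_assoc coact_eps comp_idl comp_idr //.
- have GGP := HG GP.
  apply: (pbk_uniq GGP).
  + rewrite -!comp_assoc -delta_nat -fmap_comp em_pb_actl fmap_comp !comp_assoc.
    by rewrite em_pb_actl -!comp_assoc coact_delta.
  + rewrite -!comp_assoc -delta_nat -fmap_comp em_pb_actr fmap_comp !comp_assoc.
    by rewrite em_pb_actr -!comp_assoc coact_delta.
Defined.

Definition em_pbl : CoalgebraHom em_pb_ob X :=
  {| cohom := pbl P : hom (carrier em_pb_ob) X; cohomP := eq_sym em_pb_actl |}.

Definition em_pbr : CoalgebraHom em_pb_ob Y :=
  {| cohom := pbr P : hom (carrier em_pb_ob) Y; cohomP := eq_sym em_pb_actr |}.

Definition em_pb_lift (W : Coalgebra G) (h : CoalgebraHom W X)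
  (k : CoalgebraHom W Y) (e : cohom f ∘ cohom h = cohom g ∘ cohom k) :
  CoalgebraHom W em_pb_ob.
Proof.
refine {| cohom := pb_lift P e : hom W (carrier em_pb_ob) |}.
have := pbl_lift P e; have := pbr_lift P e.
move: (pb_lift P _) => l er el /=.
apply: (pbk_uniq GP); rewrite -!comp_assoc -fmap_comp.
- by rewrite em_pb_actl comp_assoc el cohomP.
- by rewrite em_pb_actr comp_assoc er cohomP.
Defined.

Definition em_pb : Pullback f g.
Proof.
refine (@Build_Pullback (EM G) X Y Z f g em_pb_ob em_pbl em_pbr _).
unshelve refine (@Build_IsPullback (EM G) X Y Z em_pb_ob f g em_pbl em_pbr _
  (fun W h k e => em_pb_lift (f_equal (@cohom E G W Z) e)) _ _ _).
- by apply: cohom_eq; exact: pb_comm.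
- by move=> W h k e; apply: cohom_eq; rewrite /= pbl_lift.
- by move=> W h k e; apply: cohom_eq; rewrite /= pbr_lift.
- move=> W h k el er; apply: cohom_eq; apply: (pb_eq (P := P)).
  + exact: (f_equal (@cohom _ _ _ _) el).
  + exact: (f_equal (@cohom _ _ _ _) er).
Defined.
End EMPullbacks.

Definition EM_pullbacks (E : Category) (PB : HasPullbacks E) (G : Comonad E)
  (HG : PreservesPullbacks G) : HasPullbacks (EM G) :=
  fun X Y Z f g => em_pb PB HG f g.

(** [bhom V A B] is the hom category V(A,B); [tens g f] is the horizontal
    composite g ⊗ f, on 1-cells, and [tens2] its action on 2-cells. *)
Record Bicategory := {
  bob :> Type;
  bhom : bob -> bob -> Category;
  bid : forall A, bhom A A;
  tens : forall A B C, bhom B C -> bhom A B -> bhom A C;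
  tens2 : forall A B C (g g' : bhom B C) (f f' : bhom A B),
    hom g g' -> hom f f' -> hom (tens g f) (tens g' f');
  tens2_id : forall A B C (g : bhom B C) (f : bhom A B),
    tens2 (idm g) (idm f) = idm (tens g f);
  tens2_comp : forall A B C (g g' g'' : bhom B C) (f f' f'' : bhom A B)
    (b' : hom g' g'') (b : hom g g') (a' : hom f' f'') (a : hom f f'),
    tens2 (b' ∘ b) (a' ∘ a) = tens2 b' a' ∘ tens2 b a;
  assoc : forall A B C D (h : bhom C D) (g : bhom B C) (f : bhom A B),
    hom (tens (tens h g) f) (tens h (tens g f));
  assoc_inv : forall A B C D (h : bhom C D) (g : bhom B C) (f : bhom A B),
    hom (tens h (tens g f)) (tens (tens h g) f);
  lun : forall A B (f : bhom A B), hom (tens (bid B) f) f;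
  lun_inv : forall A B (f : bhom A B), hom f (tens (bid B) f);
  run : forall A B (f : bhom A B), hom (tens f (bid A)) f;
  run_inv : forall A B (f : bhom A B), hom f (tens f (bid A));
  assoc_assoc_inv : forall A B C D (h : bhom C D) (g : bhom B C) (f : bhom A B),
    assoc h g f ∘ assoc_inv h g f = idm _;
  assoc_inv_assoc : forall A B C D (h : bhom C D) (g : bhom B C) (f : bhom A B),
    assoc_inv h g f ∘ assoc h g f = idm _;
  lun_lun_inv : forall A B (f : bhom A B), lun f ∘ lun_inv f = idm _;
  lun_inv_lun : forall A B (f : bhom A B), lun_inv f ∘ lun f = idm _;
  run_run_inv : forall A B (f : bhom A B), run f ∘ run_inv f = idm _;
  run_inv_run : forall A B (f : bhom A B), run_inv f ∘ run f = idm _;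
  assoc_nat : forall A B C D (h h' : bhom C D) (g g' : bhom B C)
    (f f' : bhom A B) (c : hom h h') (b : hom g g') (a : hom f f'),
    assoc h' g' f' ∘ tens2 (tens2 c b) a = tens2 c (tens2 b a) ∘ assoc h g f;
  lun_nat : forall A B (f f' : bhom A B) (a : hom f f'),
    lun f' ∘ tens2 (idm (bid B)) a = a ∘ lun f;
  run_nat : forall A B (f f' : bhom A B) (a : hom f f'),
    run f' ∘ tens2 a (idm (bid A)) = a ∘ run f;
  pentagon : forall A B C D F (k : bhom D F) (h : bhom C D) (g : bhom B C)
    (f : bhom A B),
    tens2 (idm k) (assoc h g f) ∘ assoc k (tens h g) f
      ∘ tens2 (assoc k h g) (idm f)
    = assoc k h (tens g f) ∘ assoc (tens k h) g f;
  triangle : forall A B C (g : bhom B C) (f : bhom A B),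
    tens2 (idm g) (lun f) ∘ assoc g (bid B) f = tens2 (run g) (idm f) }.
Arguments bhom {_} _ _.
Arguments bid {_} A.
Arguments tens {_ A B C} _ _.
Arguments tens2 {_ A B C g g' f f'} _ _.
Arguments assoc {_ A B C D} h g f.
Arguments assoc_inv {_ A B C D} h g f.
Arguments lun {_ A B} f.
Arguments lun_inv {_ A B} f.
Arguments run {_ A B} f.
Arguments run_inv {_ A B} f.

Notation "g ⊗ f" := (tens g f) (at level 40, left associativity) : cat_scope.
Notation "b ⊗⊗ a" := (tens2 b a) (at level 40, left associativity) : cat_scope.

(** A morphism W -> V of Caten.  The span of sets Ob W <- Ob A -> Ob V is
    encoded by its fibres: [mob w v] is the set of objects A with A_- = w and
    A_+ = v.  With this encoding composition of spans of sets by pullback is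
    the dependent sum over the middle object, and functions commuting with
    (-)_- and (-)_+ are families of functions between fibres. *)
Record Morphism (W V : Bicategory) := {
  mob : W -> V -> Type;
  mhom : forall w w' v v' (A : mob w v) (A' : mob w' v'),
    Functor (bhom w w') (bhom v v');
  mmu : forall w w' w'' v v' v'' (A : mob w v) (A' : mob w' v')
    (A'' : mob w'' v'') (f' : bhom w' w'') (f : bhom w w'),
    hom (mhom A' A'' f' ⊗ mhom A A' f) (mhom A A'' (f' ⊗ f));
  meta : forall w v (A : mob w v), hom (bid v) (mhom A A (bid w));
  mmu_nat : forall w w' w'' v v' v'' (A : mob w v) (A' : mob w' v')
    (A'' : mob w'' v'') (f' g' : bhom w' w'') (f g : bhom w w')
    (b : hom f' g') (a : hom f g),
    mmu A A' A'' g' g ∘ (fmap (mhom A' A'') b ⊗⊗ fmap (mhom A A') a)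
    = fmap (mhom A A'') (b ⊗⊗ a) ∘ mmu A A' A'' f' f;
  mmu_assoc : forall w w' w'' w''' v v' v'' v''' (A : mob w v)
    (A' : mob w' v') (A'' : mob w'' v'') (A''' : mob w''' v''')
    (h : bhom w'' w''') (g : bhom w' w'') (f : bhom w w'),
    fmap (mhom A A''') (assoc h g f) ∘ mmu A A' A''' (h ⊗ g) f
      ∘ (mmu A' A'' A''' h g ⊗⊗ idm (mhom A A' f))
    = mmu A A'' A''' h (g ⊗ f)
      ∘ (idm (mhom A'' A''' h) ⊗⊗ mmu A A' A'' g f) ∘ assoc _ _ _;
  mmu_unitl : forall w w' v v' (A : mob w v) (A' : mob w' v') (f : bhom w w'),
    fmap (mhom A A') (lun f) ∘ mmu A A' A' (bid w') f
      ∘ (meta A' ⊗⊗ idm (mhom A A' f)) = lun _;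
  mmu_unitr : forall w w' v v' (A : mob w v) (A' : mob w' v') (f : bhom w w'),
    fmap (mhom A A') (run f) ∘ mmu A A A' f (bid w)
      ∘ (idm (mhom A A' f) ⊗⊗ meta A) = run _ }.
Arguments mob {W V} _ _ _.
Arguments mhom {W V} _ {w w' v v'} A A'.
Arguments mmu {W V} _ {w w' w'' v v' v''} A A' A'' f' f.
Arguments meta {W V} _ {w v} A.

(** The identity span of Ob W, encoded by its fibres. *)
Inductive IdOb (W : Bicategory) : W -> W -> Type := idob (w : W) : IdOb w w.
Arguments idob {W} w.

Section IdMorphism.
Variable W : Bicategory.

Definition idm_hom (w w' v v' : W) (A : IdOb w v) (A' : IdOb w' v') :
  Functor (bhom w w') (bhom v v') :=
  match A in IdOb w v, A' in IdOb w' v'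
    return Functor (bhom w w') (bhom v v') with
  | idob w, idob w' => IdFunctor (bhom w w')
  end.

Definition idm_mu (w w' w'' v v' v'' : W) (A : IdOb w v) (A' : IdOb w' v')
  (A'' : IdOb w'' v'') : forall (f' : bhom w' w'') (f : bhom w w'),
  hom (idm_hom A' A'' f' ⊗ idm_hom A A' f) (idm_hom A A'' (f' ⊗ f)) :=
  match A in IdOb w v, A' in IdOb w' v', A'' in IdOb w'' v''
    return forall (f' : bhom w' w'') (f : bhom w w'),
      hom (idm_hom A' A'' f' ⊗ idm_hom A A' f) (idm_hom A A'' (f' ⊗ f)) with
  | idob _, idob _, idob _ => fun f' f => idm (f' ⊗ f)
  end.

Definition idm_eta (w v : W) (A : IdOb w v) : hom (bid v) (idm_hom A A (bid w)) :=
  match A in IdOb w v return hom (bid v) (idm_hom A A (bid w)) with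
  | idob w => idm (bid w)
  end.

Definition IdMorphism : Morphism W W.
Proof.
refine {| mob := @IdOb W; mhom := idm_hom; mmu := idm_mu; meta := idm_eta |}.
- move=> w w' w'' v v' v'' [{}w] [{}w'] [{}w''] f' g' f g b a /=.
  by rewrite comp_idl comp_idr.
- move=> w w' w'' w''' v v' v'' v''' [{}w] [{}w'] [{}w''] [{}w'''] h g f /=.
  by rewrite !tens2_id !comp_idl comp_idr.
- move=> w w' v v' [{}w] [{}w'] f /=.
  by rewrite tens2_id !comp_idr.
- move=> w w' v v' [{}w] [{}w'] f /=.
  by rewrite tens2_id !comp_idr.
Defined.
End IdMorphism.

(** The composite B ∘ A: an object is a pair (A, B) with A_+ = B_-. *)
Section CompMorphism.
Variables (W V U : Bicategory) (B : Morphism V U) (A : Morphism W V).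

Definition CompMorphism : Morphism W U.
Proof.
refine {|
  mob := fun w u => {v : V & (mob A w v * mob B v u)%type};
  mhom := fun w w' u u' X X' =>
    CompFunctor (mhom B (snd (projT2 X)) (snd (projT2 X')))
                (mhom A (fst (projT2 X)) (fst (projT2 X')));
  mmu := fun w w' w'' u u' u'' X X' X'' f' f =>
    fmap (mhom B (snd (projT2 X)) (snd (projT2 X'')))
      (mmu A (fst (projT2 X)) (fst (projT2 X')) (fst (projT2 X'')) f' f)
    ∘ mmu B (snd (projT2 X)) (snd (projT2 X')) (snd (projT2 X'')) _ _;
  meta := fun w u X =>
    fmap (mhom B (snd (projT2 X)) (snd (projT2 X))) (meta A (fst (projT2 X)))
    ∘ meta B (snd (projT2 X)) |}.
- move=> w w' w'' u u' u'' [v [X Y]] [v' [X' Y']] [v'' [X'' Y'']] f' g' f g b a /=.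
  by rewrite comp_assoc mmu_nat -!comp_assoc -!fmap_comp mmu_nat.
- move=> w w' w'' w''' u u' u'' u''' [v [X Y]] [v' [X' Y']] [v'' [X'' Y'']]
    [v''' [X''' Y''']] h g f /=.
  rewrite -{1}(comp_idl (idm (mhom B Y Y' (mhom A X X' f)))) tens2_comp.
  rewrite -{1}(comp_idl (idm (mhom B Y'' Y''' (mhom A X'' X''' h)))) tens2_comp.
  rewrite -!fmap_id !comp_assoc.
  rewrite -(comp_assoc (mmu B Y Y' Y''' _ _)) mmu_nat.
  rewrite -(comp_assoc (mmu B Y Y'' Y''' _ _)) mmu_nat !comp_assoc.
  rewrite !fmap_id -mmu_assoc.
  by rewrite -!comp_assoc -!fmap_comp !comp_assoc mmu_assoc.
- move=> w w' u u' [v [X Y]] [v' [X' Y']] f /=.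
  rewrite -{1}(comp_idl (idm (mhom B Y Y' (mhom A X X' f)))) tens2_comp.
  rewrite -fmap_id !comp_assoc -(comp_assoc (mmu B Y Y' Y' _ _)) mmu_nat.
  by rewrite -!comp_assoc -!fmap_comp !comp_assoc mmu_unitl !fmap_id mmu_unitl.
- move=> w w' u u' [v [X Y]] [v' [X' Y']] f /=.
  rewrite -{1}(comp_idl (idm (mhom B Y Y' (mhom A X X' f)))) tens2_comp.
  rewrite -fmap_id !comp_assoc -(comp_assoc (mmu B Y Y Y' _ _)) mmu_nat.
  by rewrite -!comp_assoc -!fmap_comp !comp_assoc mmu_unitr !fmap_id mmu_unitr.
Defined.
End CompMorphism.

(** 2-cells of Caten; compatibility with (-)_- and (-)_+ is in the typing. *)
Record EnrichedFunctor (W V : Bicategory) (A B : Morphism W V) := {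
  efob :> forall w v, mob A w v -> mob B w v;
  efhom : forall w w' v v' (X : mob A w v) (X' : mob A w' v') (f : bhom w w'),
    hom (mhom A X X' f) (mhom B (efob X) (efob X') f);
  efhom_nat : forall w w' v v' (X : mob A w v) (X' : mob A w' v')
    (f g : bhom w w') (a : hom f g),
    efhom X X' g ∘ fmap (mhom A X X') a
    = fmap (mhom B (efob X) (efob X')) a ∘ efhom X X' f;
  efhom_mu : forall w w' w'' v v' v'' (X : mob A w v) (X' : mob A w' v')
    (X'' : mob A w'' v'') (f' : bhom w' w'') (f : bhom w w'),
    efhom X X'' (f' ⊗ f) ∘ mmu A X X' X'' f' f
    = mmu B (efob X) (efob X') (efob X'') f' f
      ∘ (efhom X' X'' f' ⊗⊗ efhom X X' f);
  efhom_eta : forall w v (X : mob A w v),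
    efhom X X (bid w) ∘ meta A X = meta B (efob X) }.
Arguments efob {W V A B} _ {w v} _.
Arguments efhom {W V A B} _ {w w' v v'} X X' f.

Definition IdEnriched (W V : Bicategory) (A : Morphism W V) :
  EnrichedFunctor A A.
Proof.
refine {| efob := fun w v X => X;
          efhom := fun w w' v v' X X' f => idm (mhom A X X' f) |}.
- by move=> *; rewrite comp_idl comp_idr.
- by move=> *; rewrite tens2_id comp_idl comp_idr.
- by move=> *; rewrite comp_idl.
Defined.

Definition CompEnriched (W V : Bicategory) (A B C : Morphism W V)
  (E : EnrichedFunctor B C) (F : EnrichedFunctor A B) : EnrichedFunctor A C.
Proof.
refine {| efob := fun w v X => E w v (F w v X);
          efhom := fun w w' v v' X X' f =>
            efhom E (F _ _ X) (F _ _ X') f ∘ efhom F X X' f |}.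
- by move=> *; rewrite comp_assoc efhom_nat -comp_assoc efhom_nat comp_assoc.
- by move=> *; rewrite comp_assoc efhom_mu -comp_assoc efhom_mu comp_assoc tens2_comp.
- by move=> *; rewrite comp_assoc !efhom_eta.
Defined.

(** 3-cells of Caten.  The two sides of the usual equation end in the values
    of B at 1 ⊗ f and f ⊗ 1; the unit isomorphisms bring both to f. *)
Record ThreeCell (W V : Bicategory) (A B : Morphism W V)
    (F E : EnrichedFunctor A B) := {
  psi :> forall w v (X : mob A w v),
    hom (bid v) (mhom B (efob F X) (efob E X) (bid w));
  psiP : forall w w' v v' (X : mob A w v) (X' : mob A w' v') (f : bhom w w'),
    fmap (mhom B (efob F X) (efob E X')) (lun f)
      ∘ mmu B (efob F X) (efob F X') (efob E X') (bid w') f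
      ∘ (psi X' ⊗⊗ efhom F X X' f) ∘ lun_inv _
    = fmap (mhom B (efob F X) (efob E X')) (run f)
      ∘ mmu B (efob F X) (efob E X) (efob E X') f (bid w)
      ∘ (efhom E X X' f ⊗⊗ psi X) ∘ run_inv _ }.
Arguments psi {W V A B F E} _ {w v} X.

(** Components of the identity 3-cell on F, and of the vertical composite
    F -> E -> H. *)
Definition id3_at (W V : Bicategory) (A B : Morphism W V)
  (F : EnrichedFunctor A B) w v (X : mob A w v) :
  hom (bid v) (mhom B (efob F X) (efob F X) (bid w)) := meta B (efob F X).

Definition comp3_at (W V : Bicategory) (A B : Morphism W V)
  (F E H : EnrichedFunctor A B) (chi : ThreeCell E H) (phi : ThreeCell F E)
  w v (X : mob A w v) :
  hom (bid v) (mhom B (efob F X) (efob H X) (bid w)) :=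
  fmap (mhom B (efob F X) (efob H X)) (lun (bid w))
  ∘ mmu B (efob F X) (efob E X) (efob H X) (bid w) (bid w)
  ∘ (psi chi X ⊗⊗ psi phi X) ∘ lun_inv (bid v).

Definition Iso3 (W V : Bicategory) (A B : Morphism W V)
  (F E : EnrichedFunctor A B) : Prop :=
  exists (phi : ThreeCell F E) (chi : ThreeCell E F),
    (forall w v (X : mob A w v), comp3_at chi phi X = id3_at F X) /\
    (forall w v (X : mob A w v), comp3_at phi chi X = id3_at E X).

(** Equivalence of 1-cells in Caten, i.e. equivalence of objects in the
    bicategory Caten(W,V). *)
Definition EquivalentMorphisms (W V : Bicategory) (A B : Morphism W V) : Prop :=
  exists (F : EnrichedFunctor A B) (E : EnrichedFunctor B A),
    Iso3 (CompEnriched E F) (IdEnriched A) /\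
    Iso3 (CompEnriched F E) (IdEnriched B).

(** Equivalence of objects in the tricategory Caten: the composites are
    equivalent, not isomorphic, to identities. *)
Definition CatenEquivalent (W V : Bicategory) : Prop :=
  exists (A : Morphism W V) (B : Morphism V W),
    EquivalentMorphisms (CompMorphism B A) (IdMorphism W) /\
    EquivalentMorphisms (CompMorphism A B) (IdMorphism V).

(** A comonad on V in Caten; since its counit is a function over Ob V x Ob V
    into the identity span, (-)_- = (-)_+, written [cob0].  The underlying
    comonads [chom X X'] carry the components of the counit and of the
    comultiplication, and the last four laws say that these are enriched
    functors to the identity and to the composite of the comonad with itself. *)
Record CatenComonad (V : Bicategory) := {
  cob :> Type;
  cob0 : cob -> V;
  chom : forall X X' : cob, Comonad (bhom (cob0 X) (cob0 X'));
  cmu : forall (X X' X'' : cob) (f' : bhom (cob0 X') (cob0 X''))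
    (f : bhom (cob0 X) (cob0 X')),
    hom (chom X' X'' f' ⊗ chom X X' f) (chom X X'' (f' ⊗ f));
  ceta : forall X : cob, hom (bid (cob0 X)) (chom X X (bid (cob0 X)));
  cmu_nat : forall (X X' X'' : cob) (f' g' : bhom (cob0 X') (cob0 X''))
    (f g : bhom (cob0 X) (cob0 X')) (b : hom f' g') (a : hom f g),
    cmu g' g ∘ (fmap (chom X' X'') b ⊗⊗ fmap (chom X X') a)
    = fmap (chom X X'') (b ⊗⊗ a) ∘ cmu f' f;
  cmu_assoc : forall (X X' X'' X''' : cob)
    (h : bhom (cob0 X'') (cob0 X''')) (g : bhom (cob0 X') (cob0 X''))
    (f : bhom (cob0 X) (cob0 X')),
    fmap (chom X X''') (assoc h g f) ∘ cmu (h ⊗ g) f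
      ∘ (cmu h g ⊗⊗ idm (chom X X' f))
    = cmu h (g ⊗ f) ∘ (idm (chom X'' X''' h) ⊗⊗ cmu g f) ∘ assoc _ _ _;
  cmu_unitl : forall (X X' : cob) (f : bhom (cob0 X) (cob0 X')),
    fmap (chom X X') (lun f) ∘ cmu (bid (cob0 X')) f
      ∘ (ceta X' ⊗⊗ idm (chom X X' f)) = lun _;
  cmu_unitr : forall (X X' : cob) (f : bhom (cob0 X) (cob0 X')),
    fmap (chom X X') (run f) ∘ cmu f (bid (cob0 X))
      ∘ (idm (chom X X' f) ⊗⊗ ceta X) = run _;
  ceps_mu : forall (X X' X'' : cob) (f' : bhom (cob0 X') (cob0 X''))
    (f : bhom (cob0 X) (cob0 X')),
    eps (chom X X'') (f' ⊗ f) ∘ cmu f' f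
    = eps (chom X' X'') f' ⊗⊗ eps (chom X X') f;
  ceps_eta : forall X : cob,
    eps (chom X X) (bid (cob0 X)) ∘ ceta X = idm _;
  cdelta_mu : forall (X X' X'' : cob) (f' : bhom (cob0 X') (cob0 X''))
    (f : bhom (cob0 X) (cob0 X')),
    delta (chom X X'') (f' ⊗ f) ∘ cmu f' f
    = fmap (chom X X'') (cmu f' f)
      ∘ cmu (chom X' X'' f') (chom X X' f)
      ∘ (delta (chom X' X'') f' ⊗⊗ delta (chom X X') f);
  cdelta_eta : forall X : cob,
    delta (chom X X) (bid (cob0 X)) ∘ ceta X
    = fmap (chom X X) (ceta X) ∘ ceta X }.
Arguments cob0 {V _} X.
Arguments chom {V} _ X X'.
Arguments cmu {V _ X X' X''} f' f.
Arguments ceta {V _} X.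

(** The bicategory of coalgebras; coherence cells are those of V. *)
Section EMBicat.
Variables (V : Bicategory) (G : CatenComonad V).

Definition emb_id (X : G) : EM (chom G X X).
Proof.
refine (@Build_Coalgebra _ (chom G X X) (bid (cob0 X)) (ceta X) _ _).
- exact: ceps_eta.
- exact: cdelta_eta.
Defined.

Definition emb_tens (X X' X'' : G) (g : EM (chom G X' X''))
  (f : EM (chom G X X')) : EM (chom G X X'').
Proof.
refine (@Build_Coalgebra _ (chom G X X'') (carrier g ⊗ carrier f)
  (cmu (carrier g) (carrier f) ∘ (coact g ⊗⊗ coact f)) _ _).
- by rewrite -comp_assoc ceps_mu -tens2_comp !coact_eps tens2_id.
- rewrite -comp_assoc cdelta_mu !comp_assoc -tens2_comp !coact_delta.
  by rewrite tens2_comp -(comp_assoc (cmu _ _)) cmu_nat fmap_comp !comp_assoc.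
Defined.

Definition emb_tens2 (X X' X'' : G) (g g' : EM (chom G X' X''))
  (f f' : EM (chom G X X')) (b : hom g g') (a : hom f f') :
  hom (emb_tens g f) (emb_tens g' f').
Proof.
refine (@Build_CoalgebraHom _ (chom G X X'') (emb_tens g f) (emb_tens g' f')
  (cohom b ⊗⊗ cohom a) _).
by rewrite /= comp_assoc -tens2_comp !cohomP tens2_comp -!comp_assoc cmu_nat.
Defined.

Lemma inv_cohomP (C : Category) (K : Comonad C) (X Y : Coalgebra K)
  (f : hom (carrier X) (carrier Y)) (g : hom (carrier Y) (carrier X)) :
  f ∘ g = idm _ -> g ∘ f = idm _ ->
  coact Y ∘ f = fmap K f ∘ coact X -> coact X ∘ g = fmap K g ∘ coact Y.
Proof.
move=> fg gf e.
rewrite -(comp_idr (coact Y)) -fg -(comp_assoc (coact Y)) e.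
by rewrite -!comp_assoc -fmap_comp gf fmap_id comp_idl.
Qed.

Section Assoc.
Variables (X X' X'' X''' : G) (h : EM (chom G X'' X'''))
  (g : EM (chom G X' X'')) (f : EM (chom G X X')).

Lemma emb_assocP :
  coact (emb_tens h (emb_tens g f)) ∘ assoc (carrier h) (carrier g) (carrier f)
  = fmap (chom G X X''') (assoc (carrier h) (carrier g) (carrier f))
    ∘ coact (emb_tens (emb_tens h g) f).
Proof.
rewrite /= -{2}(comp_idl (coact f)) tens2_comp.
rewrite -{1}(comp_idl (coact h)) tens2_comp.
rewrite !comp_assoc -assoc_nat.
rewrite -(comp_assoc (idm _ ⊗⊗ _)) -(comp_assoc (cmu _ _)) -cmu_assoc.
by rewrite !comp_assoc.
Qed.

Definition emb_assoc :
  hom (emb_tens (emb_tens h g) f) (emb_tens h (emb_tens g f)) :=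
  {| cohom := assoc (carrier h) (carrier g) (carrier f) :
       hom (carrier (emb_tens (emb_tens h g) f))
           (carrier (emb_tens h (emb_tens g f)));
     cohomP := emb_assocP |}.

Definition emb_assoc_inv :
  hom (emb_tens h (emb_tens g f)) (emb_tens (emb_tens h g) f) :=
  {| cohom := assoc_inv (carrier h) (carrier g) (carrier f) :
       hom (carrier (emb_tens h (emb_tens g f)))
           (carrier (emb_tens (emb_tens h g) f));
     cohomP := @inv_cohomP _ _ (emb_tens (emb_tens h g) f)
       (emb_tens h (emb_tens g f)) _ _ (assoc_assoc_inv _ _ _)
       (assoc_inv_assoc _ _ _) emb_assocP |}.
End Assoc.

Section Units.
Variables (X X' : G) (f : EM (chom G X X')).

Lemma emb_lunP :
  coact f ∘ lun (carrier f)
  = fmap (chom G X X') (lun (carrier f)) ∘ coact (emb_tens (emb_id X') f).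
Proof.
rewrite /= -lun_nat -cmu_unitl !comp_assoc -tens2_comp.
by rewrite comp_idr comp_idl.
Qed.

Lemma emb_runP :
  coact f ∘ run (carrier f)
  = fmap (chom G X X') (run (carrier f)) ∘ coact (emb_tens f (emb_id X)).
Proof.
rewrite /= -run_nat -cmu_unitr !comp_assoc -tens2_comp.
by rewrite comp_idr comp_idl.
Qed.

Definition emb_lun : hom (emb_tens (emb_id X') f) f :=
  {| cohom := lun (carrier f) : hom (carrier (emb_tens (emb_id X') f)) _;
     cohomP := emb_lunP |}.

Definition emb_lun_inv : hom f (emb_tens (emb_id X') f) :=
  {| cohom := lun_inv (carrier f) : hom _ (carrier (emb_tens (emb_id X') f));
     cohomP := @inv_cohomP _ _ (emb_tens (emb_id X') f) f _ _
       (lun_lun_inv _) (lun_inv_lun _) emb_lunP |}.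

Definition emb_run : hom (emb_tens f (emb_id X)) f :=
  {| cohom := run (carrier f) : hom (carrier (emb_tens f (emb_id X))) _;
     cohomP := emb_runP |}.

Definition emb_run_inv : hom f (emb_tens f (emb_id X)) :=
  {| cohom := run_inv (carrier f) : hom _ (carrier (emb_tens f (emb_id X)));
     cohomP := @inv_cohomP _ _ (emb_tens f (emb_id X)) f _ _
       (run_run_inv _) (run_inv_run _) emb_runP |}.
End Units.

Definition EMBicat : Bicategory.
Proof.
refine {| bob := cob G; bhom := fun X X' => EM (chom G X X'); bid := emb_id;
  tens := emb_tens; tens2 := emb_tens2; assoc := emb_assoc;
  assoc_inv := emb_assoc_inv; lun := emb_lun; lun_inv := emb_lun_inv;
  run := emb_run; run_inv := emb_run_inv |}; move=> *; apply: cohom_eq => /=.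
- exact: tens2_id.
- exact: tens2_comp.
- exact: assoc_assoc_inv.
- exact: assoc_inv_assoc.
- exact: lun_lun_inv.
- exact: lun_inv_lun.
- exact: run_run_inv.
- exact: run_inv_run.
- exact: assoc_nat.
- exact: lun_nat.
- exact: run_nat.
- exact: pentagon.
- exact: triangle.
Defined.
End EMBicat.

Record Span (E : Category) (A B : E) := {
  apex : E;
  lleg : hom apex A;
  rleg : hom apex B }.

Record SpanHom (E : Category) (A B : E) (S T : Span A B) := {
  shm : hom (apex S) (apex T);
  shm_l : lleg T ∘ shm = lleg S;
  shm_r : rleg T ∘ shm = rleg S }.

Lemma shm_eq (E : Category) (A B : E) (S T : Span A B) (f g : SpanHom S T) :
  shm f = shm g -> f = g.
Proof.
case: f g => [f fl fr] [g gl gr] /= e; subst g.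
by rewrite (proof_irrelevance _ fl gl) (proof_irrelevance _ fr gr).
Qed.

Definition SpanCat (E : Category) (A B : E) : Category.
Proof.
unshelve refine {| ob := Span A B; hom := @SpanHom E A B;
  idm := fun S => {| shm := idm (apex S) |};
  comp := fun S T U g f => {| shm := shm g ∘ shm f |} |}.
- by rewrite comp_idr.
- by rewrite comp_idr.
- by rewrite -comp_assoc !shm_l.
- by rewrite -comp_assoc !shm_r.
- by move=> S T f; apply: shm_eq; rewrite /= comp_idl.
- by move=> S T f; apply: shm_eq; rewrite /= comp_idr.
- by move=> S T U W h g f; apply: shm_eq; rewrite /= comp_assoc.
Defined.

Section Chains.
Variables (C : Category) (a b c d e f g : C).

Lemma ch21 (p : hom c d) (q : hom b c) (s : hom b d) (z : hom a b) :
  p ∘ q = s -> p ∘ q ∘ z = s ∘ z.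
Proof. by move=> <-; rewrite comp_assoc. Qed.

Lemma ch22 (p : hom c d) (q : hom b c) (s : hom e d) (t : hom b e)
  (z : hom a b) : p ∘ q = s ∘ t -> p ∘ q ∘ z = s ∘ t ∘ z.
Proof. by move=> h; rewrite -!comp_assoc h. Qed.

Lemma ch32 (p : hom d e) (q : hom c d) (r : hom b c) (s : hom f e)
  (t : hom b f) (z : hom a b) :
  p ∘ q ∘ r = s ∘ t -> p ∘ q ∘ r ∘ z = s ∘ t ∘ z.
Proof. by move=> h; rewrite -[RHS]comp_assoc -h !comp_assoc. Qed.
End Chains.

(** L with its three projections is the limit of A -> B <- S -> B' <- A'. *)
Record IsZigzagLimit (E : Category) (A B S B' A' L : E) (a : hom A B)
    (u : hom S B) (v : hom S B') (a' : hom A' B')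
    (pA : hom L A) (pS : hom L S) (pA' : hom L A') := {
  zz_comml : a ∘ pA = u ∘ pS;
  zz_commr : v ∘ pS = a' ∘ pA';
  zz_lift : forall X (x : hom X A) (s : hom X S) (x' : hom X A'),
    a ∘ x = u ∘ s -> v ∘ s = a' ∘ x' -> hom X L;
  zz_liftA : forall X (x : hom X A) (s : hom X S) (x' : hom X A')
    (e : a ∘ x = u ∘ s) (e' : v ∘ s = a' ∘ x'), pA ∘ zz_lift e e' = x;
  zz_liftS : forall X (x : hom X A) (s : hom X S) (x' : hom X A')
    (e : a ∘ x = u ∘ s) (e' : v ∘ s = a' ∘ x'), pS ∘ zz_lift e e' = s;
  zz_liftA' : forall X (x : hom X A) (s : hom X S) (x' : hom X A')
    (e : a ∘ x = u ∘ s) (e' : v ∘ s = a' ∘ x'), pA' ∘ zz_lift e e' = x';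
  zz_uniq : forall X (h k : hom X L),
    pA ∘ h = pA ∘ k -> pS ∘ h = pS ∘ k -> pA' ∘ h = pA' ∘ k -> h = k }.

(** The map induced on limits by a morphism of diagrams. *)
Section ZigzagMap.
Variables (E : Category).
Variables (A B S B' A' L : E) (a : hom A B) (u : hom S B) (v : hom S B')
  (a' : hom A' B') (pA : hom L A) (pS : hom L S) (pA' : hom L A').
Variables (C D T D' C' M : E) (c : hom C D) (w : hom T D) (z : hom T D')
  (c' : hom C' D') (qC : hom M C) (qT : hom M T) (qC' : hom M C').
Variables (ZL : IsZigzagLimit a u v a' pA pS pA')
          (ZM : IsZigzagLimit c w z c' qC qT qC').
Variables (f : hom A C) (g : hom B D) (h : hom S T) (g' : hom B' D')
          (f' : hom A' C').
Hypotheses (e1 : c ∘ f = g ∘ a) (e2 : g ∘ u = w ∘ h)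
           (e3 : z ∘ h = g' ∘ v) (e4 : g' ∘ a' = c' ∘ f').

Lemma zz_map_subproof1 : c ∘ f ∘ pA = w ∘ h ∘ pS.
Proof. by rewrite -!comp_assoc e1 -e2 !comp_assoc (zz_comml ZL). Qed.

Lemma zz_map_subproof2 : z ∘ h ∘ pS = c' ∘ f' ∘ pA'.
Proof. by rewrite -!comp_assoc e3 -e4 !comp_assoc (zz_commr ZL). Qed.

Definition zz_map : hom L M :=
  zz_lift ZM zz_map_subproof1 zz_map_subproof2.

Lemma zz_mapA : qC ∘ zz_map = f ∘ pA. Proof. exact: zz_liftA. Qed.
Lemma zz_mapS : qT ∘ zz_map = h ∘ pS. Proof. exact: zz_liftS. Qed.
Lemma zz_mapA' : qC' ∘ zz_map = f' ∘ pA'. Proof. exact: zz_liftA'. Qed.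
End ZigzagMap.

Definition id_zigzag (E : Category) (A S A' : E) (u : hom S A) (v : hom S A') :
  IsZigzagLimit (idm A) u v (idm A') u (idm S) v.
Proof.
refine {| zz_lift := fun X x s x' _ _ => s |}.
- by rewrite comp_idl comp_idr.
- by rewrite comp_idl comp_idr.
- by move=> X x s x' <- _; rewrite comp_idl.
- by move=> *; rewrite comp_idl.
- by move=> X x s x' _ ->; rewrite comp_idl.
- by move=> X h k _; rewrite !comp_idl.
Defined.

Section PullbacksZigzag.
Variables (E : Category) (A B S B' A' P L : E) (a : hom A B)
  (u : hom S B) (v : hom S B') (a' : hom A' B') (w : hom P B')
  (pA : hom P A) (pS : hom P S) (pP : hom L P) (pA' : hom L A')
  (qA : hom L A) (qS : hom L S).
Hypotheses (HP : IsPullback a u pA pS) (ew : w = v ∘ pS)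
  (HL : IsPullback w a' pP pA') (eA : qA = pA ∘ pP) (eS : qS = pS ∘ pP).

Lemma pullbacks_zigzag_subproof X (x : hom X A) (s : hom X S) (x' : hom X A')
  (e : a ∘ x = u ∘ s) (e' : v ∘ s = a' ∘ x') : w ∘ pbk_lift HP e = a' ∘ x'.
Proof. by rewrite ew comp_assoc pbk_liftr. Qed.

Definition pullbacks_zigzag : IsZigzagLimit a u v a' qA qS pA'.
Proof.
refine {| zz_lift := fun X x s x' e e' =>
            pbk_lift HL (pullbacks_zigzag_subproof e e') |}.
- by rewrite eA eS -!comp_assoc (pbk_comm HP).
- by rewrite eS -comp_assoc -ew (pbk_comm HL).
- by move=> X x s x' e e'; rewrite eA comp_assoc !pbk_liftl.
- by move=> X x s x' e e'; rewrite eS comp_assoc pbk_liftl pbk_liftr.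
- by move=> X x s x' e e'; rewrite pbk_liftr.
- move=> X h k; rewrite eA eS !comp_assoc => hA hS hA'.
  by apply: (pbk_uniq HL) => //; apply: (pbk_uniq HP).
Defined.
End PullbacksZigzag.

Section ShmEq.
Variables (E : Category) (A B : E).

Lemma shm_eq22 (S T T' U : SpanCat A B) (g : hom T U) (f : hom S T)
  (k : hom T' U) (h : hom S T') :
  shm g ∘ shm f = shm k ∘ shm h -> g ∘ f = k ∘ h.
Proof. by move=> e; apply: shm_eq. Qed.

Lemma shm_eq23 (S T T' T'' U : SpanCat A B) (g : hom T U) (f : hom S T)
  (k : hom T' U) (h : hom T'' T') (l : hom S T'') :
  shm g ∘ shm f = shm k ∘ shm h ∘ shm l -> g ∘ f = k ∘ h ∘ l.
Proof. by move=> e; apply: shm_eq. Qed.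

Lemma shm_eq33 (S T1 T2 T3 T4 U : SpanCat A B) (f : hom T1 U)
  (g : hom T2 T1) (h : hom S T2) (k : hom T3 U) (l : hom T4 T3)
  (m : hom S T4) :
  shm f ∘ shm g ∘ shm h = shm k ∘ shm l ∘ shm m ->
  f ∘ g ∘ h = k ∘ l ∘ m.
Proof. by move=> e; apply: shm_eq. Qed.

Lemma shm_eq31 (S T1 T2 U : SpanCat A B) (f : hom T1 U)
  (g : hom T2 T1) (h : hom S T2) (k : hom S U) :
  shm f ∘ shm g ∘ shm h = shm k -> f ∘ g ∘ h = k.
Proof. by move=> e; apply: shm_eq. Qed.
End ShmEq.

Section Spn.
Variables (E : Category) (PB : HasPullbacks E).

Definition sp_id (A : E) : SpanCat A A :=
  {| apex := A; lleg := idm A; rleg := idm A |}.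

Definition sp_tens (A B C : E) (T : SpanCat B C) (S : SpanCat A B) :
  SpanCat A C :=
  {| apex := PB (rleg S) (lleg T);
     lleg := lleg S ∘ pbl _; rleg := rleg T ∘ pbr _ |}.

Definition tl (A B C : E) (T : SpanCat B C) (S : SpanCat A B) :
  hom (apex (sp_tens T S)) (apex S) := pbl (PB (rleg S) (lleg T)).
Definition tr (A B C : E) (T : SpanCat B C) (S : SpanCat A B) :
  hom (apex (sp_tens T S)) (apex T) := pbr (PB (rleg S) (lleg T)).

Definition tlift (A B C : E) (T : SpanCat B C) (S : SpanCat A B) (X : E)
  (h : hom X (apex S)) (k : hom X (apex T)) (e : rleg S ∘ h = lleg T ∘ k) :
  hom X (apex (sp_tens T S)) := pb_lift (PB (rleg S) (lleg T)) e.

Section Theory.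
Variables (A B C : E) (T : SpanCat B C) (S : SpanCat A B).

Lemma lleg_tens : lleg (sp_tens T S) = lleg S ∘ tl T S.
Proof. by []. Qed.

Lemma rleg_tens : rleg (sp_tens T S) = rleg T ∘ tr T S.
Proof. by []. Qed.

Lemma t_comm : rleg S ∘ tl T S = lleg T ∘ tr T S.
Proof. exact: pb_comm. Qed.

Lemma t_eq X (h k : hom X (apex (sp_tens T S))) :
  tl T S ∘ h = tl T S ∘ k -> tr T S ∘ h = tr T S ∘ k -> h = k.
Proof. exact: pb_eq. Qed.

Lemma tl_lift X (h : hom X (apex S)) (k : hom X (apex T))
  (e : rleg S ∘ h = lleg T ∘ k) : tl T S ∘ tlift e = h.
Proof. exact: pbl_lift. Qed.

Lemma tr_lift X (h : hom X (apex S)) (k : hom X (apex T))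
  (e : rleg S ∘ h = lleg T ∘ k) : tr T S ∘ tlift e = k.
Proof. exact: pbr_lift. Qed.

Lemma t_commA X (x : hom X (apex (sp_tens T S))) :
  rleg S ∘ tl T S ∘ x = lleg T ∘ tr T S ∘ x.
Proof. by rewrite -!comp_assoc t_comm. Qed.

Lemma tl_liftA X Y (h : hom X (apex S)) (k : hom X (apex T))
  (e : rleg S ∘ h = lleg T ∘ k) (x : hom Y X) : tl T S ∘ tlift e ∘ x = h ∘ x.
Proof. by rewrite -comp_assoc tl_lift. Qed.

Lemma tr_liftA X Y (h : hom X (apex S)) (k : hom X (apex T))
  (e : rleg S ∘ h = lleg T ∘ k) (x : hom Y X) : tr T S ∘ tlift e ∘ x = k ∘ x.
Proof. by rewrite -comp_assoc tr_lift. Qed.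
End Theory.

Lemma shm_lA (A B : E) (S T : SpanCat A B) (f : hom S T) X
  (x : hom X (apex S)) : lleg T ∘ shm f ∘ x = lleg S ∘ x.
Proof. by rewrite -comp_assoc shm_l. Qed.

Lemma shm_rA (A B : E) (S T : SpanCat A B) (f : hom S T) X
  (x : hom X (apex S)) : rleg T ∘ shm f ∘ x = rleg S ∘ x.
Proof. by rewrite -comp_assoc shm_r. Qed.

Definition sp_tens2 (A B C : E) (T T' : SpanCat B C) (S S' : SpanCat A B)
  (b : hom T T') (a : hom S S') : hom (sp_tens T S) (sp_tens T' S').
Proof.
unshelve refine (@Build_SpanHom E A C (sp_tens T S) (sp_tens T' S')
  (@tlift A B C T' S' _ (shm a ∘ tl T S) (shm b ∘ tr T S) _) _ _).
- by rewrite shm_lA shm_rA t_comm.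
- by rewrite !lleg_tens comp_assoc tl_lift shm_lA.
- by rewrite !rleg_tens comp_assoc tr_lift shm_rA.
Defined.

Lemma shm_comp (A B : E) (S T U : SpanCat A B) (g : hom T U) (f : hom S T) :
  shm (g ∘ f) = shm g ∘ shm f.
Proof. by []. Qed.
Lemma shm_id (A B : E) (S : SpanCat A B) : shm (idm S) = idm (apex S).
Proof. by []. Qed.

Section Tens2.
Variables (A B C : E) (T T' : SpanCat B C) (S S' : SpanCat A B).
Variables (b : hom T T') (a : hom S S').

Lemma tl_tens2 : tl T' S' ∘ shm (sp_tens2 b a) = shm a ∘ tl T S.
Proof. exact: tl_lift. Qed.
Lemma tr_tens2 : tr T' S' ∘ shm (sp_tens2 b a) = shm b ∘ tr T S.
Proof. exact: tr_lift. Qed.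
Lemma tl_tens2A X (x : hom X _) :
  tl T' S' ∘ shm (sp_tens2 b a) ∘ x = shm a ∘ tl T S ∘ x.
Proof. by rewrite -comp_assoc tl_tens2 comp_assoc. Qed.
Lemma tr_tens2A X (x : hom X _) :
  tr T' S' ∘ shm (sp_tens2 b a) ∘ x = shm b ∘ tr T S ∘ x.
Proof. by rewrite -comp_assoc tr_tens2 comp_assoc. Qed.
End Tens2.

Section SpAssoc.
Variables (A B C D : E).
Variables (U : SpanCat C D) (T : SpanCat B C) (S : SpanCat A B).

Lemma sp_assoc_subproof1 :
  rleg S ∘ tl (sp_tens U T) S = lleg T ∘ tl U T ∘ tr (sp_tens U T) S.
Proof. by rewrite t_comm lleg_tens comp_assoc. Qed.

Lemma sp_assoc_subproof2 :
  rleg (sp_tens T S) ∘ tlift sp_assoc_subproof1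
  = lleg U ∘ tr U T ∘ tr (sp_tens U T) S.
Proof. by rewrite rleg_tens comp_assoc tr_lift t_commA. Qed.

Definition sp_assoc :
  hom (sp_tens (sp_tens U T) S) (sp_tens U (sp_tens T S)).
Proof.
refine (@Build_SpanHom E A D (sp_tens (sp_tens U T) S)
  (sp_tens U (sp_tens T S)) (tlift sp_assoc_subproof2) _ _).
- by rewrite !lleg_tens !comp_assoc !tl_lift.
- by rewrite !rleg_tens !comp_assoc tr_lift.
Defined.

Lemma sp_assoc_inv_subproof1 :
  rleg T ∘ tr T S ∘ tl U (sp_tens T S) = lleg U ∘ tr U (sp_tens T S).
Proof. by rewrite -t_comm rleg_tens comp_assoc. Qed.

Lemma sp_assoc_inv_subproof2 :
  rleg S ∘ tl T S ∘ tl U (sp_tens T S)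
  = lleg (sp_tens U T) ∘ tlift sp_assoc_inv_subproof1.
Proof. by rewrite lleg_tens comp_assoc tl_lift t_commA. Qed.

Definition sp_assoc_inv :
  hom (sp_tens U (sp_tens T S)) (sp_tens (sp_tens U T) S).
Proof.
refine (@Build_SpanHom E A D (sp_tens U (sp_tens T S))
  (sp_tens (sp_tens U T) S) (tlift sp_assoc_inv_subproof2) _ _).
- by rewrite !lleg_tens !comp_assoc tl_lift.
- by rewrite !rleg_tens !comp_assoc !tr_lift.
Defined.

Lemma shm_assoc : shm sp_assoc = tlift sp_assoc_subproof2.
Proof. by []. Qed.
Lemma shm_assoc_inv : shm sp_assoc_inv = tlift sp_assoc_inv_subproof2.
Proof. by []. Qed.

Lemma tl_tl_assoc :
  tl T S ∘ tl U (sp_tens T S) ∘ shm sp_assoc = tl (sp_tens U T) S.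
Proof. by rewrite shm_assoc tl_lift tl_lift. Qed.
Lemma tr_tl_assoc :
  tr T S ∘ tl U (sp_tens T S) ∘ shm sp_assoc = tl U T ∘ tr (sp_tens U T) S.
Proof. by rewrite shm_assoc tl_lift tr_lift. Qed.
Lemma tr_assoc :
  tr U (sp_tens T S) ∘ shm sp_assoc = tr U T ∘ tr (sp_tens U T) S.
Proof. by rewrite shm_assoc tr_lift. Qed.
Lemma tl_assoc_inv :
  tl (sp_tens U T) S ∘ shm sp_assoc_inv = tl T S ∘ tl U (sp_tens T S).
Proof. by rewrite shm_assoc_inv tl_lift. Qed.
Lemma tl_tr_assoc_inv :
  tl U T ∘ tr (sp_tens U T) S ∘ shm sp_assoc_inv
  = tr T S ∘ tl U (sp_tens T S).
Proof. by rewrite shm_assoc_inv tr_lift tl_lift. Qed.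
Lemma tr_tr_assoc_inv :
  tr U T ∘ tr (sp_tens U T) S ∘ shm sp_assoc_inv = tr U (sp_tens T S).
Proof. by rewrite shm_assoc_inv tr_lift tr_lift. Qed.

Lemma tl_tl_assocA X (x : hom X _) :
  tl T S ∘ tl U (sp_tens T S) ∘ shm sp_assoc ∘ x = tl (sp_tens U T) S ∘ x.
Proof. by rewrite -tl_tl_assoc !comp_assoc. Qed.
Lemma tr_tl_assocA X (x : hom X _) :
  tr T S ∘ tl U (sp_tens T S) ∘ shm sp_assoc ∘ x
  = tl U T ∘ tr (sp_tens U T) S ∘ x.
Proof. by rewrite -[RHS]comp_assoc -tr_tl_assoc !comp_assoc. Qed.
Lemma tr_assocA X (x : hom X _) :
  tr U (sp_tens T S) ∘ shm sp_assoc ∘ x = tr U T ∘ tr (sp_tens U T) S ∘ x.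
Proof. by rewrite -comp_assoc tr_assoc comp_assoc. Qed.
Lemma tl_assoc_invA X (x : hom X _) :
  tl (sp_tens U T) S ∘ shm sp_assoc_inv ∘ x = tl T S ∘ tl U (sp_tens T S) ∘ x.
Proof. by rewrite -comp_assoc tl_assoc_inv comp_assoc. Qed.
Lemma tl_tr_assoc_invA X (x : hom X _) :
  tl U T ∘ tr (sp_tens U T) S ∘ shm sp_assoc_inv ∘ x
  = tr T S ∘ tl U (sp_tens T S) ∘ x.
Proof. by rewrite -[RHS]comp_assoc -tl_tr_assoc_inv !comp_assoc. Qed.
Lemma tr_tr_assoc_invA X (x : hom X _) :
  tr U T ∘ tr (sp_tens U T) S ∘ shm sp_assoc_inv ∘ x
  = tr U (sp_tens T S) ∘ x.
Proof. by rewrite -tr_tr_assoc_inv !comp_assoc. Qed.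
End SpAssoc.

Section SpUnits.
Variables (A B : E) (S : SpanCat A B).

Definition sp_lun : hom (sp_tens (sp_id B) S) S.
Proof.
refine (@Build_SpanHom E A B (sp_tens (sp_id B) S) S
  (tl (sp_id B) S) _ _) => //.
by rewrite t_comm.
Defined.

Definition sp_run : hom (sp_tens S (sp_id A)) S.
Proof.
refine (@Build_SpanHom E A B (sp_tens S (sp_id A)) S
  (tr S (sp_id A)) _ _) => //.
by rewrite -t_comm.
Defined.

Lemma sp_lun_inv_subproof :
  rleg S ∘ idm (apex S) = lleg (sp_id B) ∘ rleg S.
Proof. by rewrite comp_idr comp_idl. Qed.

Definition sp_lun_inv : hom S (sp_tens (sp_id B) S).
Proof.
refine (@Build_SpanHom E A B S (sp_tens (sp_id B) S)
  (tlift sp_lun_inv_subproof) _ _).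
- by rewrite lleg_tens comp_assoc tl_lift comp_idr.
- by rewrite rleg_tens comp_assoc tr_lift comp_idl.
Defined.

Lemma sp_run_inv_subproof :
  rleg (sp_id A) ∘ lleg S = lleg S ∘ idm (apex S).
Proof. by rewrite comp_idr comp_idl. Qed.

Definition sp_run_inv : hom S (sp_tens S (sp_id A)).
Proof.
refine (@Build_SpanHom E A B S (sp_tens S (sp_id A))
  (tlift sp_run_inv_subproof) _ _).
- by rewrite lleg_tens comp_assoc tl_lift comp_idl.
- by rewrite rleg_tens comp_assoc tr_lift comp_idr.
Defined.

Lemma tl_lun_inv : tl (sp_id B) S ∘ shm sp_lun_inv = idm _.
Proof. exact: tl_lift. Qed.
Lemma tr_lun_inv : tr (sp_id B) S ∘ shm sp_lun_inv = rleg S.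
Proof. exact: tr_lift. Qed.
Lemma tl_run_inv : tl S (sp_id A) ∘ shm sp_run_inv = lleg S.
Proof. exact: tl_lift. Qed.
Lemma tr_run_inv : tr S (sp_id A) ∘ shm sp_run_inv = idm _.
Proof. exact: tr_lift. Qed.

Lemma shm_lun : shm sp_lun = tl (sp_id B) S.
Proof. by []. Qed.
Lemma shm_run : shm sp_run = tr S (sp_id A).
Proof. by []. Qed.

Lemma tr_sp_id : tr (sp_id B) S = rleg S ∘ tl (sp_id B) S.
Proof. by rewrite t_comm comp_idl. Qed.
Lemma tl_sp_id : tl S (sp_id A) = lleg S ∘ tr S (sp_id A).
Proof. by rewrite -t_comm comp_idl. Qed.
End SpUnits.

Ltac sp_simp := rewrite ?shm_comp ?shm_id ?shm_lun ?shm_run;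
  repeat first
    [ rewrite comp_assoc | rewrite comp_idl | rewrite comp_idr
    | rewrite tl_tl_assocA | rewrite tr_tl_assocA | rewrite tr_assocA
    | rewrite tl_assoc_invA | rewrite tl_tr_assoc_invA | rewrite tr_tr_assoc_invA
    | rewrite tl_tens2A | rewrite tr_tens2A
    | rewrite tl_tl_assoc | rewrite tr_tl_assoc | rewrite tr_assoc
    | rewrite tl_assoc_inv | rewrite tl_tr_assoc_inv | rewrite tr_tr_assoc_inv
    | rewrite tl_tens2 | rewrite tr_tens2
    | rewrite shm_id | rewrite shm_comp | rewrite shm_lun | rewrite shm_run
    ].

Definition Spn : Bicategory.
Proof.
refine {| bob := ob E; bhom := @SpanCat E; bid := sp_id; tens := sp_tens;
  tens2 := sp_tens2; assoc := sp_assoc; assoc_inv := sp_assoc_inv;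
  lun := sp_lun; lun_inv := sp_lun_inv; run := sp_run; run_inv := sp_run_inv |};
  move=> *; apply: shm_eq.
- by apply: t_eq; rewrite ?tl_tens2 ?tr_tens2 !shm_id comp_idl comp_idr.
- by apply: t_eq; rewrite !shm_comp ?tl_tens2A ?tr_tens2A ?tl_tens2 ?tr_tens2
    !shm_comp !comp_assoc.
- apply: t_eq; [apply: t_eq|]; rewrite shm_comp shm_id comp_idr ?tl_tl_assocA
    ?tr_tl_assocA ?tr_assocA ?tl_assoc_inv ?tl_tr_assoc_inv ?tr_tr_assoc_inv //.
- apply: t_eq; [|apply: t_eq]; rewrite shm_comp shm_id comp_idr ?tl_assoc_invA
    ?tl_tr_assoc_invA ?tr_tr_assoc_invA ?tl_tl_assoc ?tr_tl_assoc ?tr_assoc //.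
- by rewrite shm_comp shm_lun tl_lun_inv.
- by apply: t_eq; rewrite shm_comp shm_lun shm_id comp_idr -comp_assoc
    ?tl_lun_inv ?tr_lun_inv ?comp_idl -?tr_sp_id.
- by rewrite shm_comp shm_run tr_run_inv.
- by apply: t_eq; rewrite shm_comp shm_run shm_id comp_idr -comp_assoc
    ?tl_run_inv ?tr_run_inv ?comp_idl -?tl_sp_id.
- by apply: t_eq; [apply: t_eq|]; rewrite !shm_comp ?tl_tl_assocA
    ?tr_tl_assocA ?tr_assocA ?tl_tens2A ?tr_tens2A ?tl_tens2 ?tr_tens2
    ?tl_tl_assoc ?tr_tl_assoc ?tr_assoc ?tl_tens2A ?tr_tens2A ?comp_assoc
    ?tl_tl_assoc ?tr_tl_assoc ?tr_assoc.
- by rewrite !shm_comp !shm_lun tl_tens2.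
- by rewrite !shm_comp !shm_run tr_tens2.
- by apply: t_eq; [apply: t_eq; [apply: t_eq|]|]; sp_simp.
- by apply: t_eq; sp_simp; rewrite // -tl_sp_id.
Defined.

(** [lower h] is h_* and [upper h] is h^*. *)
Definition lower (A B : Spn) (h : @hom E A B) : bhom A B :=
  {| apex := A : E; lleg := idm (A : E); rleg := h |}.

Definition upper (A B : Spn) (h : @hom E A B) : bhom B A :=
  {| apex := A : E; lleg := h; rleg := idm (A : E) |}.

Definition counit (A B : Spn) (h : @hom E A B) :
  hom (lower h ⊗ upper h) (bid B).
Proof.
refine (@Build_SpanHom E B B (lower h ⊗ upper h) (bid B)
  (h ∘ tl (lower h) (upper h)) _ _); rewrite comp_idl //.
by rewrite rleg_tens -(comp_idl (tr _ _)) -(t_comm (lower h)) comp_idl.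
Defined.

Variables (G : Comonad E) (HG : PreservesPullbacks G).

Definition spG (A B : Spn) (S : bhom A B) : bhom (G A : Spn) (G B : Spn) :=
  {| apex := G (apex S); lleg := fmap G (lleg S); rleg := fmap G (rleg S) |}.

Definition spG2 (A B : Spn) (S T : bhom A B) (f : hom S T) :
  hom (spG S) (spG T).
Proof.
refine (@Build_SpanHom E (G A) (G B) (spG S) (spG T) (fmap G (shm f)) _ _).
- by rewrite /= -fmap_comp shm_l.
- by rewrite /= -fmap_comp shm_r.
Defined.

Section SpGTens.
Variables (A B C : Spn) (T : bhom B C) (S : bhom A B).

Definition G_tens_pullback :
  IsPullback (fmap G (rleg S)) (fmap G (lleg T))
             (fmap G (tl T S)) (fmap G (tr T S)) :=
  HG (pb_is (PB (rleg S) (lleg T))).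

Definition spG_tens_map : hom (apex (spG T ⊗ spG S)) (apex (spG (T ⊗ S))) :=
  pbk_lift G_tens_pullback (t_comm (spG T) (spG S)).

Lemma tl_spG_tens : fmap G (tl T S) ∘ spG_tens_map = tl (spG T) (spG S).
Proof. exact: pbk_liftl. Qed.

Lemma tr_spG_tens : fmap G (tr T S) ∘ spG_tens_map = tr (spG T) (spG S).
Proof. exact: pbk_liftr. Qed.

Definition spG_tens : hom (spG T ⊗ spG S) (spG (T ⊗ S)).
Proof.
refine (@Build_SpanHom E (G A) (G C) (spG T ⊗ spG S) (spG (T ⊗ S))
  spG_tens_map _ _).
- change (fmap G (lleg S ∘ tl T S) ∘ spG_tens_map
          = fmap G (lleg S) ∘ tl (spG T) (spG S)).
  by rewrite fmap_comp comp_assoc tl_spG_tens.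
- change (fmap G (rleg T ∘ tr T S) ∘ spG_tens_map
          = fmap G (rleg T) ∘ tr (spG T) (spG S)).
  by rewrite fmap_comp comp_assoc tr_spG_tens.
Defined.

Lemma G_tens_eq X (h k : hom X (G (apex (sp_tens T S)))) :
  fmap G (tl T S) ∘ h = fmap G (tl T S) ∘ k ->
  fmap G (tr T S) ∘ h = fmap G (tr T S) ∘ k -> h = k.
Proof. exact: pbk_uniq G_tens_pullback _ _ _. Qed.
End SpGTens.

(** The hom comonad on Spn(E)(A,A') attached to coalgebras X = (A,gamma) and
    X' = (A',gamma'). *)
Section HomComonad.
Variables X X' : Coalgebra G.

Definition gconj (S : bhom (carrier X : Spn) (carrier X' : Spn)) :
  bhom (carrier X : Spn) (carrier X' : Spn) :=
  upper (coact X') ⊗ (spG S ⊗ lower (coact X)).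

Definition gconj2 (S T : bhom (carrier X : Spn) (carrier X' : Spn))
  (f : hom S T) : hom (gconj S) (gconj T) :=
  idm (upper (coact X')) ⊗⊗ (spG2 f ⊗⊗ idm (lower (coact X))).

(** The first two are locked to keep rewriting from unfolding them. *)
Definition gA S : hom (apex (gconj S)) (carrier X) :=
  locked (tl (spG S) (lower (coact X))
          ∘ tl (upper (coact X')) (spG S ⊗ lower (coact X))).
Definition gS S : hom (apex (gconj S)) (G (apex S)) :=
  locked (tr (spG S) (lower (coact X))
          ∘ tl (upper (coact X')) (spG S ⊗ lower (coact X))).
Definition gA' S : hom (apex (gconj S)) (carrier X') :=
  tr (upper (coact X')) (spG S ⊗ lower (coact X)).

Lemma gAE S : gA S = tl (spG S) (lower (coact X))
                     ∘ tl (upper (coact X')) (spG S ⊗ lower (coact X)).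
Proof. by rewrite /gA -lock. Qed.

Lemma gSE S : gS S = tr (spG S) (lower (coact X))
                     ∘ tl (upper (coact X')) (spG S ⊗ lower (coact X)).
Proof. by rewrite /gS -lock. Qed.

Definition gconj_zigzag S :
  IsZigzagLimit (coact X) (fmap G (lleg S)) (fmap G (rleg S)) (coact X')
    (gA S) (gS S) (gA' S) :=
  pullbacks_zigzag
    (pb_is (PB (coact X) (fmap G (lleg S))))
    (rleg_tens (spG S) (lower (coact X)) :
       rleg (spG S ⊗ lower (coact X))
       = fmap G (rleg S) ∘ pbr (PB (coact X) (fmap G (lleg S))))
    (pb_is (PB (rleg (spG S ⊗ lower (coact X))) (coact X')))
    (gAE S) (gSE S).

Definition G_gconj_zigzag S :
  IsZigzagLimit (fmap G (coact X)) (fmap G (fmap G (lleg S)))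
    (fmap G (fmap G (rleg S))) (fmap G (coact X'))
    (fmap G (gA S)) (fmap G (gS S)) (fmap G (gA' S)) :=
  pullbacks_zigzag
    (HG (pb_is (PB (coact X) (fmap G (lleg S)))))
    (fmap_comp G (fmap G (rleg S)) (tr (spG S) (lower (coact X))) :
       fmap G (rleg (spG S ⊗ lower (coact X)))
       = fmap G (fmap G (rleg S))
         ∘ fmap G (pbr (PB (coact X) (fmap G (lleg S)))))
    (HG (pb_is (PB (rleg (spG S ⊗ lower (coact X))) (coact X'))))
    (eq_trans (f_equal (fmap G) (gAE S)) (fmap_comp G _ _))
    (eq_trans (f_equal (fmap G) (gSE S)) (fmap_comp G _ _)).

Lemma lleg_gconj S : lleg (gconj S) = gA S.
Proof. by rewrite gAE !lleg_tens comp_idl. Qed.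

Lemma rleg_gconj S : rleg (gconj S) = gA' S.
Proof. by rewrite rleg_tens comp_idl. Qed.

Lemma gS_gconj2 S T (f : hom S T) :
  gS T ∘ shm (gconj2 f) = fmap G (shm f) ∘ gS S.
Proof.
by rewrite !gSE comp_assoc tl_tens2 -comp_assoc tr_tens2 comp_assoc.
Qed.

Lemma coact_mono (Y : Coalgebra G) : Mono (coact Y).
Proof.
move=> Z h k e.
by rewrite -(comp_idl h) -(comp_idl k) -(coact_eps Y) !comp_assoc e.
Qed.

Lemma gS_mono S : Mono (gS S).
Proof.
move=> Z h k e; apply: (zz_uniq (gconj_zigzag S)) => //.
- apply: (@coact_mono X).
  by rewrite -!comp_assoc (zz_comml (gconj_zigzag S)) !comp_assoc e.
- apply: (@coact_mono X').
  by rewrite -!comp_assoc -(zz_commr (gconj_zigzag S)) !comp_assoc e.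
Qed.

Lemma G_gS_mono S : Mono (fmap G (gS S)).
Proof. by apply: preserves_mono => //; exact: gS_mono. Qed.

Lemma gS_gconj2A S T (f : hom S T) Z (z : hom Z _) :
  gS T ∘ shm (gconj2 f) ∘ z = fmap G (shm f) ∘ gS S ∘ z.
Proof. by rewrite -comp_assoc gS_gconj2 comp_assoc. Qed.

(** gconj (gconj S) as the limit of A -> GGA <- GGS -> GGA' <- A'. *)
Section Gconj2Zigzag.
Variables (S : bhom (carrier X : Spn) (carrier X' : Spn)).

Section Lift.
Variables (Z : E) (x : hom Z (carrier X)) (s : hom Z (G (G (apex S))))
  (x' : hom Z (carrier X')).
Hypothesis (e : (fmap G (coact X) ∘ coact X) ∘ x = fmap G (fmap G (lleg S)) ∘ s).
Hypothesis (e' : fmap G (fmap G (rleg S)) ∘ s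
                 = (fmap G (coact X') ∘ coact X') ∘ x').

Definition gconj2_lift_G : hom Z (G (apex (gconj S))) :=
  zz_lift (G_gconj_zigzag S)
    (eq_trans (eq_sym (comp_assoc _ _ _)) e)
    (eq_trans e' (comp_assoc _ _ _)).

Lemma gconj2_lift_subproof1 :
  coact X ∘ x = fmap G (lleg (gconj S)) ∘ gconj2_lift_G.
Proof. by rewrite lleg_gconj zz_liftA. Qed.

Lemma gconj2_lift_subproof2 :
  fmap G (rleg (gconj S)) ∘ gconj2_lift_G = coact X' ∘ x'.
Proof. by rewrite rleg_gconj zz_liftA'. Qed.

Definition gconj2_lift : hom Z (apex (gconj (gconj S))) :=
  zz_lift (gconj_zigzag (gconj S)) gconj2_lift_subproof1 gconj2_lift_subproof2.
End Lift.

Definition gconj2_zigzag :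
  IsZigzagLimit (fmap G (coact X) ∘ coact X) (fmap G (fmap G (lleg S)))
    (fmap G (fmap G (rleg S))) (fmap G (coact X') ∘ coact X')
    (gA (gconj S)) (fmap G (gS S) ∘ gS (gconj S)) (gA' (gconj S)).
Proof.
refine {| zz_lift := gconj2_lift |}.
- rewrite comp_assoc (zz_comml (gconj_zigzag (gconj S))) -!comp_assoc.
  by rewrite -!fmap_comp lleg_gconj (zz_comml (gconj_zigzag S)).
- rewrite comp_assoc -(zz_commr (gconj_zigzag (gconj S))) -!comp_assoc.
  by rewrite -!fmap_comp rleg_gconj (zz_commr (gconj_zigzag S)).
- by move=> Z x s x' e e'; exact: zz_liftA.
- by move=> Z x s x' e e'; rewrite comp_assoc !zz_liftS.
- by move=> Z x s x' e e'; exact: zz_liftA'.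
- move=> Z h k _ e _; apply: gS_mono; apply: G_gS_mono.
  by rewrite -!comp_assoc.
Defined.
End Gconj2Zigzag.

Section DeltaEps.
Variables (S : bhom (carrier X : Spn) (carrier X' : Spn)).

Lemma gdelta_subproof (Y : Coalgebra G) :
  (fmap G (coact Y) ∘ coact Y) ∘ idm _ = delta G (carrier Y) ∘ coact Y.
Proof. by rewrite comp_idr coact_delta. Qed.

(** Induced by 1_A, delta_A, delta_S, delta_A', 1_A'. *)
Definition gdelta_map : hom (apex (gconj S)) (apex (gconj (gconj S))) :=
  zz_map (gconj_zigzag S) (gconj2_zigzag S)
    (f := idm (carrier X)) (g := delta G (carrier X))
    (h := delta G (apex S))
    (g' := delta G (carrier X')) (f' := idm (carrier X'))
    (gdelta_subproof X) (delta_nat G (lleg S))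
    (eq_sym (delta_nat G (rleg S))) (eq_sym (gdelta_subproof X')).

Definition gdelta : hom (gconj S) (gconj (gconj S)).
Proof.
refine (@Build_SpanHom E (carrier X) (carrier X') (gconj S) (gconj (gconj S))
  gdelta_map _ _).
- by rewrite !lleg_gconj zz_mapA comp_idl.
- by rewrite !rleg_gconj zz_mapA' comp_idl.
Defined.

Lemma geps_subproof (Y : Coalgebra G) :
  idm _ ∘ idm (carrier Y) = eps G (carrier Y) ∘ coact Y.
Proof. by rewrite comp_idr coact_eps. Qed.

(** Induced by 1_A, eps_A, eps_S, eps_A', 1_A'. *)
Definition geps_map : hom (apex (gconj S)) (apex S) :=
  zz_map (gconj_zigzag S) (id_zigzag (lleg S) (rleg S))
    (f := idm (carrier X)) (g := eps G (carrier X)) (h := eps G (apex S))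
    (g' := eps G (carrier X')) (f' := idm (carrier X'))
    (geps_subproof X) (eps_nat G (lleg S))
    (eq_sym (eps_nat G (rleg S))) (eq_sym (geps_subproof X')).

Definition geps : hom (gconj S) S.
Proof.
refine (@Build_SpanHom E (carrier X) (carrier X') (gconj S) S geps_map _ _).
- by rewrite lleg_gconj zz_mapA comp_idl.
- by rewrite rleg_gconj zz_mapA' comp_idl.
Defined.

Lemma gS_gdelta :
  fmap G (gS S) ∘ gS (gconj S) ∘ shm gdelta = delta G (apex S) ∘ gS S.
Proof. by rewrite -comp_assoc zz_mapS. Qed.

Lemma gS_gdeltaA Z (z : hom Z _) :
  fmap G (gS S) ∘ gS (gconj S) ∘ shm gdelta ∘ z = delta G (apex S) ∘ gS S ∘ z.
Proof. by rewrite -[RHS]comp_assoc -gS_gdelta !comp_assoc. Qed.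

Lemma shm_geps : shm geps = eps G (apex S) ∘ gS S.
Proof. by rewrite -[LHS]comp_idl; exact: zz_mapS. Qed.
End DeltaEps.

Definition gconj_functor : Functor (bhom (carrier X : Spn) (carrier X' : Spn))
  (bhom (carrier X : Spn) (carrier X' : Spn)).
Proof.
refine {| fob := gconj; fmap := gconj2 |}.
- move=> S; apply: shm_eq; apply: gS_mono.
  by rewrite gS_gconj2 !shm_id fmap_id comp_idl comp_idr.
- move=> S T U g f; apply: shm_eq; apply: gS_mono.
  by rewrite shm_comp gS_gconj2 gS_gconj2A gS_gconj2 -comp_assoc -fmap_comp.
Defined.

Definition gconj_comonad : Comonad (bhom (carrier X : Spn) (carrier X' : Spn)).
Proof.
refine {| cm_functor := gconj_functor; delta := gdelta; eps := geps |}.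
- move=> S T f; apply: shm_eq; apply: gS_mono; apply: G_gS_mono.
  rewrite !shm_comp gS_gdeltaA gS_gconj2 gS_gconj2A.
  rewrite -(comp_assoc (fmap G (gS T))) -fmap_comp gS_gconj2 fmap_comp.
  by rewrite !comp_assoc gS_gdelta -!comp_assoc delta_nat.
- move=> S T f; apply: shm_eq.
  by rewrite !shm_comp !shm_geps comp_assoc gS_gconj2 -!comp_assoc eps_nat.
- move=> S; apply: shm_eq; apply: gS_mono.
  rewrite shm_comp shm_geps shm_id comp_idr.
  rewrite -!comp_assoc -eps_nat !comp_assoc gS_gdelta.
  by rewrite -comp_assoc eps_delta comp_idl.
- move=> S; apply: shm_eq; apply: gS_mono.
  rewrite shm_comp shm_id comp_idr gS_gconj2A shm_geps fmap_comp comp_assoc.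
  by rewrite gS_gdelta -comp_assoc feps_delta comp_idl.
- move=> S; apply: shm_eq; apply: gS_mono; apply: G_gS_mono.
  rewrite !shm_comp gS_gdeltaA gS_gconj2A.
  apply: (preserves_mono HG (@G_gS_mono S)).
  rewrite -!(comp_assoc (fmap G (fmap G (gS S)))) -delta_nat -!fmap_comp.
  rewrite !comp_assoc gS_gdelta.
  rewrite -[fmap G (_ ∘ _) ∘ _]comp_assoc -fmap_comp comp_assoc.
  rewrite gS_gdelta fmap_comp comp_assoc gS_gdelta.
  by rewrite -!comp_assoc delta_delta.
Defined.

End HomComonad.
Arguments gconj X X' S : clear implicits.
Arguments gconj2 X X' {S T} f.
Arguments gS X X' S : clear implicits.
Arguments gdelta X X' S : clear implicits.
Arguments geps X X' S : clear implicits.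

(** The unit: the unique 2-cell 1_A -> gconj 1_A, which is invertible. *)
Section Eta.
Variable X : Coalgebra G.

Lemma geta_subproof1 :
  coact X ∘ idm (carrier X) = fmap G (lleg (sp_id (carrier X))) ∘ coact X.
Proof. by rewrite fmap_id comp_idl comp_idr. Qed.

Lemma geta_subproof2 :
  fmap G (rleg (sp_id (carrier X))) ∘ coact X = coact X ∘ idm (carrier X).
Proof. by rewrite fmap_id comp_idl comp_idr. Qed.

Definition geta_map : hom (carrier X) (apex (gconj X X (sp_id (carrier X)))) :=
  zz_lift (gconj_zigzag (X := X) (X' := X) (sp_id (carrier X)))
    geta_subproof1 geta_subproof2.

Definition geta : hom (bid (carrier X : Spn)) (gconj X X (bid (carrier X : Spn))).
Proof.
refine (@Build_SpanHom E (carrier X) (carrier X) (sp_id (carrier X))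
  (gconj X X (sp_id (carrier X))) geta_map _ _).
- by rewrite lleg_gconj zz_liftA.
- by rewrite rleg_gconj zz_liftA'.
Defined.

Lemma gS_geta : gS X X (sp_id (carrier X)) ∘ shm geta = coact X.
Proof. exact: zz_liftS. Qed.

Lemma gS_bid : gS X X (sp_id (carrier X)) = coact X ∘ gA (X':=X) (sp_id (carrier X)).
Proof. by rewrite (zz_comml (gconj_zigzag _)) fmap_id comp_idl. Qed.

Lemma geta_unique
  (f : hom (bid (carrier X : Spn)) (gconj X X (bid (carrier X : Spn)))) : f = geta.
Proof.
apply: shm_eq; apply: gS_mono; rewrite gS_geta gS_bid comp_assoc -lleg_gconj.
by rewrite (shm_l f) comp_idr.
Qed.

Lemma geta_inv :
  shm geta ∘ lleg (gconj X X (sp_id (carrier X))) = idm _ /\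
  lleg (gconj X X (sp_id (carrier X))) ∘ shm geta = idm _.
Proof.
split; last exact: (shm_l geta).
by apply: gS_mono; rewrite -comp_assoc gS_geta comp_idr lleg_gconj gS_bid.
Qed.
End Eta.

(** The pasting U K L' U' H L -> U K H L -> U W L of a 2-cell c : L' U' -> 1
    and a 2-cell m : K H -> W. *)
Section Pasting.
Variables (A B A' B' B'' C : E).
Variables (U : SpanCat B'' C) (K : SpanCat B' B'') (L' : SpanCat A' B')
  (U' : SpanCat B' A') (H : SpanCat B B') (L : SpanCat A B) (W : SpanCat B B'').
Variables (c : hom (sp_tens L' U') (sp_id B')) (m : hom (sp_tens K H) W).

Definition paste_mid : hom (sp_tens (sp_tens K L') (sp_tens U' (sp_tens H L)))
                           (sp_tens W L) :=
  sp_tens2 m (idm L) ∘ sp_assoc_inv K H L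
  ∘ sp_tens2 (idm K) (sp_lun (sp_tens H L) ∘ sp_tens2 c (idm (sp_tens H L))
                      ∘ sp_assoc_inv L' U' (sp_tens H L))
  ∘ sp_assoc K L' (sp_tens U' (sp_tens H L)).

Definition paste : hom (sp_tens (sp_tens U (sp_tens K L'))
                                (sp_tens U' (sp_tens H L)))
                       (sp_tens U (sp_tens W L)) :=
  sp_tens2 (idm U) paste_mid
  ∘ sp_assoc U (sp_tens K L') (sp_tens U' (sp_tens H L)).

Lemma tl_paste (x : hom (apex W) (apex H)) :
  x ∘ shm m = tl K H ->
  x ∘ (tr W L ∘ tl U (sp_tens W L)) ∘ shm paste
  = (tr H L ∘ tl U' (sp_tens H L))
    ∘ tl (sp_tens U (sp_tens K L')) (sp_tens U' (sp_tens H L)).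
Proof.
move=> e; rewrite /paste /paste_mid; sp_simp.
rewrite -(comp_assoc x) e; by sp_simp.
Qed.

Lemma tr_paste (x : hom (apex W) (apex K)) :
  x ∘ shm m = tr K H ->
  x ∘ (tr W L ∘ tl U (sp_tens W L)) ∘ shm paste
  = (tr K L' ∘ tl U (sp_tens K L'))
    ∘ tr (sp_tens U (sp_tens K L')) (sp_tens U' (sp_tens H L)).
Proof.
move=> e; rewrite /paste /paste_mid; sp_simp.
rewrite -(comp_assoc x) e; by sp_simp.
Qed.
End Pasting.
Arguments paste {A B A' B' B'' C} U {K L' U' H} L {W} c m.

Section Mu.
Variables (X X' X'' : Coalgebra G).
Variables (T : bhom (carrier X' : Spn) (carrier X'' : Spn))
          (S : bhom (carrier X : Spn) (carrier X' : Spn)).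

(** The counit of gamma'_* -| gamma'^* followed by preservation of pullbacks. *)
Definition gmu : hom (gconj X' X'' T ⊗ gconj X X' S) (gconj X X'' (T ⊗ S)) :=
  paste (upper (coact X'')) (lower (coact X)) (counit (coact X'))
    (spG_tens T S).

Lemma tl_gmu :
  fmap G (tl T S) ∘ gS X X'' (T ⊗ S) ∘ shm gmu
  = gS X X' S ∘ tl (gconj X' X'' T) (gconj X X' S).
Proof.
rewrite (gSE (X:=X) (X':=X'') (T ⊗ S)) (gSE S).
exact: (@tl_paste _ _ _ _ _ _ (upper (coact X'')) (spG T)
  (lower (coact X')) (upper (coact X')) (spG S) (lower (coact X)) _
  (counit (coact X')) (spG_tens T S) (fmap G (tl T S)) (tl_spG_tens T S)).
Qed.
Lemma tr_gmu :
  fmap G (tr T S) ∘ gS X X'' (T ⊗ S) ∘ shm gmu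
  = gS X' X'' T ∘ tr (gconj X' X'' T) (gconj X X' S).
Proof.
rewrite (gSE (X:=X) (X':=X'') (T ⊗ S)) (gSE T).
exact: (@tr_paste _ _ _ _ _ _ (upper (coact X'')) (spG T)
  (lower (coact X')) (upper (coact X')) (spG S) (lower (coact X)) _
  (counit (coact X')) (spG_tens T S) (fmap G (tr T S)) (tr_spG_tens T S)).
Qed.

Lemma tl_gmuA Z (z : hom Z _) :
  fmap G (tl T S) ∘ gS X X'' (T ⊗ S) ∘ shm gmu ∘ z
  = gS X X' S ∘ tl (gconj X' X'' T) (gconj X X' S) ∘ z.
Proof. exact: ch32 tl_gmu. Qed.

Lemma tr_gmuA Z (z : hom Z _) :
  fmap G (tr T S) ∘ gS X X'' (T ⊗ S) ∘ shm gmu ∘ z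
  = gS X' X'' T ∘ tr (gconj X' X'' T) (gconj X X' S) ∘ z.
Proof. exact: ch32 tr_gmu. Qed.

Lemma gconj_tens_eq Z (h k : hom Z (apex (gconj X X'' (T ⊗ S)))) :
  fmap G (tl T S) ∘ gS X X'' (T ⊗ S) ∘ h
    = fmap G (tl T S) ∘ gS X X'' (T ⊗ S) ∘ k ->
  fmap G (tr T S) ∘ gS X X'' (T ⊗ S) ∘ h
    = fmap G (tr T S) ∘ gS X X'' (T ⊗ S) ∘ k -> h = k.
Proof. by move=> el er; apply: gS_mono; apply: G_tens_eq. Qed.
End Mu.



Section Laws.

Lemma gmu_nat_alg (C : Category) (c1 c2 c3 c4 c5 c6 c7 c8 c9 c10 : C)
  (P : hom c2 c1) (Q' : hom c3 c2) (m' : hom c4 c3) (t2 : hom c5 c4)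
  (gc : hom c6 c3) (m : hom c5 c6) (s' : hom c7 c1) (t' : hom c4 c7)
  (c : hom c8 c7) (t : hom c5 c8) (Fa : hom c9 c1) (s : hom c8 c9)
  (FB : hom c10 c2) (Q : hom c6 c10) (P0 : hom c10 c9) :
  P ∘ Q' ∘ m' = s' ∘ t' -> t' ∘ t2 = c ∘ t -> s' ∘ c = Fa ∘ s ->
  Q' ∘ gc = FB ∘ Q -> P ∘ FB = Fa ∘ P0 -> P0 ∘ Q ∘ m = s ∘ t ->
  P ∘ Q' ∘ m' ∘ t2 = P ∘ Q' ∘ gc ∘ m.
Proof.
move=> h1 h2 h3 h4 h5 h6.
by rewrite (ch32 _ h1) h2 (ch22 _ h3) (ch22 _ h4) (ch22 _ h5) h6.
Qed.

Lemma G_tl_tens2 (A B C : E) (T T' : SpanCat B C) (S S' : SpanCat A B)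
  (b : hom T T') (a : hom S S') :
  fmap G (tl T' S') ∘ fmap G (shm (sp_tens2 b a))
  = fmap G (shm a) ∘ fmap G (tl T S).
Proof. by rewrite -!fmap_comp tl_tens2. Qed.

Lemma G_tr_tens2 (A B C : E) (T T' : SpanCat B C) (S S' : SpanCat A B)
  (b : hom T T') (a : hom S S') :
  fmap G (tr T' S') ∘ fmap G (shm (sp_tens2 b a))
  = fmap G (shm b) ∘ fmap G (tr T S).
Proof. by rewrite -!fmap_comp tr_tens2. Qed.

Lemma gmu_nat (X X' X'' : Coalgebra G)
  (T T' : bhom (carrier X' : Spn) (carrier X'' : Spn))
  (S S' : bhom (carrier X : Spn) (carrier X' : Spn))
  (b : hom T T') (a : hom S S') :
  gmu T' S' ∘ (gconj2 X' X'' b ⊗⊗ gconj2 X X' a)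
  = gconj2 X X'' (b ⊗⊗ a) ∘ gmu T S.
Proof.
apply: shm_eq22; apply: gconj_tens_eq.
- exact: (gmu_nat_alg (tl_gmu T' S') (tl_tens2 _ _) (gS_gconj2 _)
    (gS_gconj2 _) (G_tl_tens2 _ _) (tl_gmu T S)).
- exact: (gmu_nat_alg (tr_gmu T' S') (tr_tens2 _ _) (gS_gconj2 _)
    (gS_gconj2 _) (G_tr_tens2 _ _) (tr_gmu T S)).
Qed.

Lemma gmu_eps (X X' X'' : Coalgebra G)
  (T : bhom (carrier X' : Spn) (carrier X'' : Spn))
  (S : bhom (carrier X : Spn) (carrier X' : Spn)) :
  geps X X'' (T ⊗ S) ∘ gmu T S = geps X' X'' T ⊗⊗ geps X X' S.
Proof.
apply: shm_eq; apply: t_eq; rewrite shm_comp ?tl_tens2 ?tr_tens2 !shm_geps.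
- rewrite comp_assoc -(comp_assoc (tl T S)) -eps_nat !comp_assoc.
  by rewrite tl_gmu.
- rewrite comp_assoc -(comp_assoc (tr T S)) -eps_nat !comp_assoc.
  by rewrite tr_gmu.
Qed.

Lemma geta_eps (X : Coalgebra G) :
  geps X X (bid (carrier X : Spn)) ∘ geta X = idm _.
Proof.
apply: shm_eq; rewrite shm_comp shm_geps comp_assoc gS_geta.
exact: coact_eps.
Qed.

Lemma geta_delta (X : Coalgebra G) :
  gdelta X X (bid (carrier X : Spn)) ∘ geta X
  = gconj2 X X (geta X) ∘ geta X.
Proof.
apply: shm_eq; apply: gS_mono; apply: G_gS_mono.
rewrite !shm_comp gS_gdeltaA gS_gconj2A gS_geta.
rewrite -(comp_assoc (fmap G (gS _ _ _))) -fmap_comp gS_geta.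
exact: coact_delta.
Qed.

Lemma gmu_delta_alg (C : Category)
  (c1 c2 c3 c4 c5 c6 c7 c8 c9 c10 c11 c12 c13 c14 : C)
  (P : hom c2 c1) (GQ : hom c3 c2) (Q2 : hom c4 c3) (d : hom c5 c4)
  (m : hom c6 c5) (gc : hom c7 c4) (m2 : hom c8 c7) (t2 : hom c6 c8)
  (del : hom c9 c2) (Q : hom c5 c9) (del' : hom c10 c1) (P1 : hom c9 c10)
  (s : hom c11 c10) (t : hom c6 c11) (Gm : hom c12 c3) (Q3 : hom c7 c12)
  (Gs : hom c13 c1) (Gt : hom c12 c13) (s2 : hom c14 c13) (t' : hom c8 c14)
  (d' : hom c11 c14) :
  GQ ∘ Q2 ∘ d = del ∘ Q -> del' ∘ P1 = P ∘ del -> P1 ∘ Q ∘ m = s ∘ t ->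
  Q2 ∘ gc = Gm ∘ Q3 -> P ∘ GQ ∘ Gm = Gs ∘ Gt -> Gt ∘ Q3 ∘ m2 = s2 ∘ t' ->
  t' ∘ t2 = d' ∘ t -> Gs ∘ s2 ∘ d' = del' ∘ s ->
  P ∘ GQ ∘ Q2 ∘ d ∘ m = P ∘ GQ ∘ Q2 ∘ gc ∘ m2 ∘ t2.
Proof.
move=> h1 h2 h3 h4 h5 h6 h7 h8.
rewrite (ch32 _ h1) -(ch22 _ h2) h3 (ch22 _ h4) (ch32 _ h5) (ch32 _ h6) h7.
by rewrite (ch32 _ h8).
Qed.

Lemma G_chain (C D : Category) (F : Functor C D) (a b c d e : C)
  (p : hom d e) (q : hom c d) (r : hom a c) (s : hom b e) (t : hom a b) :
  p ∘ q ∘ r = s ∘ t ->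
  fmap F p ∘ fmap F q ∘ fmap F r = fmap F s ∘ fmap F t.
Proof. by move=> h; rewrite -!fmap_comp h. Qed.

Lemma gmu_delta (X X' X'' : Coalgebra G)
  (T : bhom (carrier X' : Spn) (carrier X'' : Spn))
  (S : bhom (carrier X : Spn) (carrier X' : Spn)) :
  gdelta X X'' (T ⊗ S) ∘ gmu T S
  = gconj2 X X'' (gmu T S) ∘ gmu (gconj X' X'' T) (gconj X X' S)
    ∘ (gdelta X' X'' T ⊗⊗ gdelta X X' S).
Proof.
apply: shm_eq23; apply: gS_mono; apply: G_gS_mono.
apply: (pbk_uniq (HG (G_tens_pullback T S))).
- exact: (gmu_delta_alg (gS_gdelta (T ⊗ S)) (delta_nat G (tl T S)) (tl_gmu T S)
    (gS_gconj2 (gmu T S)) (G_chain G (tl_gmu T S))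
    (tl_gmu (gconj X' X'' T) (gconj X X' S))
    (tl_tens2 (gdelta X' X'' T) (gdelta X X' S))
    (gS_gdelta S)).
- exact: (gmu_delta_alg (gS_gdelta (T ⊗ S)) (delta_nat G (tr T S)) (tr_gmu T S)
    (gS_gconj2 (gmu T S)) (G_chain G (tr_gmu T S))
    (tr_gmu (gconj X' X'' T) (gconj X X' S))
    (tr_tens2 (gdelta X' X'' T) (gdelta X X' S))
    (gS_gdelta T)).
Qed.

Lemma gmu_unitl (X X' : Coalgebra G)
  (S : bhom (carrier X : Spn) (carrier X' : Spn)) :
  gconj2 X X' (lun S) ∘ gmu (bid (carrier X' : Spn)) S
    ∘ (geta X' ⊗⊗ idm (gconj X X' S)) = lun (gconj X X' S).
Proof.
apply: shm_eq31; apply: gS_mono; rewrite gS_gconj2A !shm_lun.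
by rewrite tl_gmuA tl_tens2 shm_id comp_idl.
Qed.

Lemma gmu_unitr (X X' : Coalgebra G)
  (S : bhom (carrier X : Spn) (carrier X' : Spn)) :
  gconj2 X X' (run S) ∘ gmu S (bid (carrier X : Spn))
    ∘ (idm (gconj X X' S) ⊗⊗ geta X) = run (gconj X X' S).
Proof.
apply: shm_eq31; apply: gS_mono; rewrite gS_gconj2A !shm_run.
by rewrite tr_gmuA tr_tens2 shm_id comp_idl.
Qed.

Lemma G_tl_tl_assoc (A B C D : E) (U : SpanCat C D) (T : SpanCat B C)
  (S : SpanCat A B) :
  fmap G (tl T S) ∘ fmap G (tl U (sp_tens T S)) ∘ fmap G (shm (sp_assoc U T S))
  = fmap G (tl (sp_tens U T) S).
Proof. by rewrite -!fmap_comp tl_tl_assoc. Qed.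

Lemma G_tr_tl_assoc (A B C D : E) (U : SpanCat C D) (T : SpanCat B C)
  (S : SpanCat A B) :
  fmap G (tr T S) ∘ fmap G (tl U (sp_tens T S)) ∘ fmap G (shm (sp_assoc U T S))
  = fmap G (tl U T) ∘ fmap G (tr (sp_tens U T) S).
Proof. by rewrite -!fmap_comp tr_tl_assoc. Qed.

Lemma G_tr_assoc (A B C D : E) (U : SpanCat C D) (T : SpanCat B C)
  (S : SpanCat A B) :
  fmap G (tr U (sp_tens T S)) ∘ fmap G (shm (sp_assoc U T S))
  = fmap G (tr U T) ∘ fmap G (tr (sp_tens U T) S).
Proof. by rewrite -!fmap_comp tr_assoc. Qed.

Lemma G_assoc_eq (A B C D : E) (U : SpanCat C D) (T : SpanCat B C)
  (S : SpanCat A B) Z (h k : hom Z (G (apex (sp_tens U (sp_tens T S))))) :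
  fmap G (tl T S) ∘ fmap G (tl U (sp_tens T S)) ∘ h
    = fmap G (tl T S) ∘ fmap G (tl U (sp_tens T S)) ∘ k ->
  fmap G (tr T S) ∘ fmap G (tl U (sp_tens T S)) ∘ h
    = fmap G (tr T S) ∘ fmap G (tl U (sp_tens T S)) ∘ k ->
  fmap G (tr U (sp_tens T S)) ∘ h = fmap G (tr U (sp_tens T S)) ∘ k -> h = k.
Proof. by move=> *; apply: G_tens_eq => //; apply: G_tens_eq. Qed.

Section AssocAlg.
Variables (C : Category) (c1 c2 c3 c4 c5 c6 c7 c8 c9 c10 c11 c12 c13 c14 c15 c16
  c17 : C).

Lemma gmu_assoc_alg1
  (Q : hom c2 c1) (gc : hom c3 c2) (m1 : hom c4 c3) (t1 : hom c5 c4)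
  (m3 : hom c6 c2) (t3 : hom c7 c6) (a : hom c5 c7)
  (Ga : hom c8 c1) (Q1 : hom c3 c8)
  (p : hom c9 c10) (q : hom c1 c9) (r : hom c8 c10)
  (s : hom c11 c10) (t : hom c4 c11) (t' : hom c5 c11)
  (sTS : hom c12 c9) (u : hom c6 c12) (mTS : hom c13 c12) (w : hom c7 c13)
  (v : hom c13 c11) :
  Q ∘ gc = Ga ∘ Q1 -> p ∘ q ∘ Ga = r -> r ∘ Q1 ∘ m1 = s ∘ t ->
  t ∘ t1 = idm _ ∘ t' ->
  q ∘ Q ∘ m3 = sTS ∘ u -> u ∘ t3 = mTS ∘ w -> p ∘ sTS ∘ mTS = s ∘ v ->
  v ∘ w ∘ a = t' ->
  p ∘ q ∘ Q ∘ gc ∘ m1 ∘ t1 = p ∘ q ∘ Q ∘ m3 ∘ t3 ∘ a.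
Proof.
move=> h1 h2 h3 h4 h5 h6 h7 h8.
rewrite (ch22 _ h1) -(comp_assoc q) -(comp_assoc p) h2 (ch32 _ h3) h4 comp_idl.
by rewrite (ch32 _ h5) (ch22 _ h6) (ch32 _ h7) h8.
Qed.

Lemma gmu_assoc_alg2
  (Q : hom c2 c1) (gc : hom c3 c2) (m1 : hom c4 c3) (t1 : hom c5 c4)
  (m3 : hom c6 c2) (t3 : hom c7 c6) (a : hom c5 c7)
  (Ga : hom c8 c1) (Q1 : hom c3 c8)
  (p : hom c9 c10) (q : hom c1 c9) (r : hom c14 c10) (r' : hom c8 c14)
  (s : hom c11 c14) (t : hom c4 c11) (mUT : hom c15 c11) (t' : hom c5 c15)
  (s' : hom c16 c10) (t'' : hom c15 c16)
  (sTS : hom c12 c9) (u : hom c6 c12) (mTS : hom c13 c12) (w : hom c7 c13)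
  (v : hom c13 c16) :
  Q ∘ gc = Ga ∘ Q1 -> p ∘ q ∘ Ga = r ∘ r' -> r' ∘ Q1 ∘ m1 = s ∘ t ->
  t ∘ t1 = mUT ∘ t' -> r ∘ s ∘ mUT = s' ∘ t'' ->
  q ∘ Q ∘ m3 = sTS ∘ u -> u ∘ t3 = mTS ∘ w -> p ∘ sTS ∘ mTS = s' ∘ v ->
  v ∘ w ∘ a = t'' ∘ t' ->
  p ∘ q ∘ Q ∘ gc ∘ m1 ∘ t1 = p ∘ q ∘ Q ∘ m3 ∘ t3 ∘ a.
Proof.
move=> h1 h2 h3 h4 h4' h5 h6 h7 h8.
rewrite (ch22 _ h1) (ch32 _ h2) (ch32 _ h3) h4 (ch32 _ h4').
by rewrite (ch32 _ h5) (ch22 _ h6) (ch32 _ h7) h8.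
Qed.

Lemma gmu_assoc_alg3
  (Q : hom c2 c1) (gc : hom c3 c2) (m1 : hom c4 c3) (t1 : hom c5 c4)
  (m3 : hom c6 c2) (t3 : hom c7 c6) (a : hom c5 c7)
  (Ga : hom c8 c1) (Q1 : hom c3 c8)
  (p : hom c1 c10) (r : hom c14 c10) (r' : hom c8 c14)
  (s : hom c11 c14) (t : hom c4 c11) (mUT : hom c15 c11) (t' : hom c5 c15)
  (s' : hom c16 c10) (t'' : hom c15 c16) (u : hom c6 c16) (w : hom c7 c16) :
  Q ∘ gc = Ga ∘ Q1 -> p ∘ Ga = r ∘ r' -> r' ∘ Q1 ∘ m1 = s ∘ t ->
  t ∘ t1 = mUT ∘ t' -> r ∘ s ∘ mUT = s' ∘ t'' ->
  p ∘ Q ∘ m3 = s' ∘ u -> u ∘ t3 = idm _ ∘ w -> w ∘ a = t'' ∘ t' ->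
  p ∘ Q ∘ gc ∘ m1 ∘ t1 = p ∘ Q ∘ m3 ∘ t3 ∘ a.
Proof.
move=> h1 h2 h3 h4 h4' h5 h6 h7.
rewrite (ch22 _ h1) (ch22 _ h2) (ch32 _ h3) h4 (ch32 _ h4').
by rewrite (ch32 _ h5) (ch22 _ h6) comp_idl h7.
Qed.
End AssocAlg.

Lemma gmu_assoc (X X' X'' X''' : Coalgebra G)
  (U : bhom (carrier X'' : Spn) (carrier X''' : Spn))
  (T : bhom (carrier X' : Spn) (carrier X'' : Spn))
  (S : bhom (carrier X : Spn) (carrier X' : Spn)) :
  gconj2 X X''' (assoc U T S) ∘ gmu (U ⊗ T) S
    ∘ (gmu U T ⊗⊗ idm (gconj X X' S))
  = gmu U (T ⊗ S) ∘ (idm (gconj X'' X''' U) ⊗⊗ gmu T S)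
    ∘ assoc (gconj X'' X''' U) (gconj X' X'' T) (gconj X X' S).
Proof.
apply: shm_eq33; apply: gS_mono; apply: G_assoc_eq.
- exact: (gmu_assoc_alg1 (gS_gconj2 (assoc U T S)) (G_tl_tl_assoc U T S)
    (tl_gmu (U ⊗ T) S) (tl_tens2 (gmu U T) (idm (gconj X X' S)))
    (tl_gmu U (T ⊗ S)) (tl_tens2 (idm (gconj X'' X''' U)) (gmu T S))
    (tl_gmu T S)
    (tl_tl_assoc (gconj X'' X''' U) (gconj X' X'' T) (gconj X X' S))).
- exact: (gmu_assoc_alg2 (gS_gconj2 (assoc U T S)) (G_tr_tl_assoc U T S)
    (tr_gmu (U ⊗ T) S) (tr_tens2 (gmu U T) (idm (gconj X X' S)))
    (tl_gmu U T) (tl_gmu U (T ⊗ S))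
    (tl_tens2 (idm (gconj X'' X''' U)) (gmu T S)) (tr_gmu T S)
    (tr_tl_assoc (gconj X'' X''' U) (gconj X' X'' T) (gconj X X' S))).
- exact: (gmu_assoc_alg3 (gS_gconj2 (assoc U T S)) (G_tr_assoc U T S)
    (tr_gmu (U ⊗ T) S) (tr_tens2 (gmu U T) (idm (gconj X X' S)))
    (tr_gmu U T) (tr_gmu U (T ⊗ S))
    (tr_tens2 (idm (gconj X'' X''' U)) (gmu T S))
    (tr_assoc (gconj X'' X''' U) (gconj X' X'' T) (gconj X X' S))).
Qed.
End Laws.

Definition SpnComonad : CatenComonad Spn :=
  @Build_CatenComonad Spn (Coalgebra G) (fun X => carrier X : Spn)
    gconj_comonad (fun X X' X'' T S => gmu T S) geta
    gmu_nat gmu_assoc gmu_unitl gmu_unitr gmu_eps geta_eps gmu_delta geta_delta.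

End Spn.

(* Main.v *)
(** A coaction [S -> gconj S] on a span [S : A -> A'] amounts to a G-coalgebra
    structure on its apex making both legs coalgebra morphisms: compose it with
    the projection [gS : gconj S -> G (apex S)] of the limit.  This identifies
    the hom categories of the two bicategories, the objects being the same.  All
    2-cells involved are determined by what they do on apices in E, and there
    the comparison constraints are determined by the two projections of the
    composite spans; so every coherence law reduces to composing projections. *)
From Corelib Require Import ssreflect.
Require Import Defs.

Set Implicit Arguments.
Unset Strict Implicit.
Unset Printing Implicit Defensive.

(** * Invertible 3-cells from equality on objects *)

Section Iso3.
Variables (W V : Bicategory) (A B : Morphism W V).

Lemma lun_conj (a b : V) (f g : bhom a b) (x : hom f g) :
  lun g ∘ (idm _ ⊗⊗ x) ∘ lun_inv f = x.
Proof. by rewrite -comp_assoc lun_nat comp_assoc lun_lun_inv comp_idr. Qed.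

Lemma run_conj (a b : V) (f g : bhom a b) (x : hom f g) :
  run g ∘ (x ⊗⊗ idm _) ∘ run_inv f = x.
Proof. by rewrite -comp_assoc run_nat comp_assoc run_run_inv comp_idr. Qed.

(** Splitting [meta B X' ⊗⊗ x] as [meta B X'] tensored with an identity after an identity tensored
    with [x] makes the unit law of [B] apply; what remains is [x] conjugated by the left unitor. *)
Lemma meta_lun w w' v v' (X : mob B w v) (X' : mob B w' v') (f : bhom w w')
  (k : bhom v v') (x : hom k (mhom B X X' f)) :
  fmap (mhom B X X') (lun f) ∘ mmu B X X' X' (bid w') f ∘ (meta B X' ⊗⊗ x)
    ∘ lun_inv k = x.
Proof.
rewrite -{2}(lun_conj x) -(mmu_unitl X X') !comp_assoc.
by rewrite -(comp_assoc (meta _ _ ⊗⊗ _)) -tens2_comp comp_idl comp_idr.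
Qed.

Lemma meta_run w w' v v' (X : mob B w v) (X' : mob B w' v') (f : bhom w w')
  (k : bhom v v') (x : hom k (mhom B X X' f)) :
  fmap (mhom B X X') (run f) ∘ mmu B X X X' f (bid w) ∘ (x ⊗⊗ meta B X)
    ∘ run_inv k = x.
Proof.
rewrite -{2}(run_conj x) -(mmu_unitr X X') !comp_assoc.
by rewrite -(comp_assoc (_ ⊗⊗ meta _ _)) -tens2_comp comp_idl comp_idr.
Qed.

(** Enriched functors with propositionally equal object maps have hom components of different types;
    this transport makes them comparable. *)
Definition efhom_cast w w' v v' (K : bhom v v') (f : bhom w w')
  (Y Z : mob B w v) (Y' Z' : mob B w' v') (e : Y = Z) (e' : Y' = Z')
  (x : hom K (mhom B Y Y' f)) : hom K (mhom B Z Z' f) :=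
  match e in _ = Z, e' in _ = Z' return hom K (mhom B Z Z' f) with
  | eq_refl, eq_refl => x
  end.

Definition meta_cast w v (Y Z : mob B w v) (e : Y = Z) :
  hom (bid v) (mhom B Y Z (bid w)) :=
  match e in _ = Z return hom (bid v) (mhom B Y Z (bid w)) with
  | eq_refl => meta B Y
  end.

Definition cast3 (F E : EnrichedFunctor A B)
  (e : forall w v (X : mob A w v), efob F X = efob E X)
  (h : forall w w' v v' (X : mob A w v) (X' : mob A w' v') (f : bhom w w'),
     efhom E X X' f = efhom_cast (e _ _ X) (e _ _ X') (efhom F X X' f)) :
  ThreeCell F E.
Proof.
refine {| psi := fun w v X => meta_cast (e w v X) |}.
move=> w w' v v' X X' f; rewrite h.
(* After [h] is used, [E] occurs only through its values on objects, so both equalities can be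
   eliminated. *)
case: _ / (e w v X); case: _ / (e w' v' X').
by rewrite meta_lun meta_run.
Defined.

(* The 3-cells are the units of B, transported along e. *)
Lemma Iso3_cast (F E : EnrichedFunctor A B)
  (e : forall w v (X : mob A w v), efob F X = efob E X) :
  (forall w w' v v' (X : mob A w v) (X' : mob A w' v') (f : bhom w w'),
     efhom E X X' f = efhom_cast (e _ _ X) (e _ _ X') (efhom F X X' f)) ->
  Iso3 F E.
Proof.
move=> h.
have h' w w' v v' (X : mob A w v) (X' : mob A w' v') (f : bhom w w') :
  efhom F X X' f = efhom_cast (eq_sym (e _ _ X)) (eq_sym (e _ _ X')) (efhom E X X' f).
  by rewrite h; case: _ / (e w v X); case: _ / (e w' v' X').
exists (cast3 h), (cast3 h'); split=> w v X; rewrite /comp3_at /id3_at /=;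
  case: _ / (e w v X) => /=; exact: meta_lun.
Qed.
End Iso3.

(** * Bicategories of spans seen through apices *)

(** Captures Spn(E), Spn(E^G) and Spn(E)^G at once: [ap] is the apex in E of a
    1-cell, and [pl], [pr] are the projections of the composite span. *)
Record SpanLike (E : Category) (V : Bicategory) := {
  ap : forall X Y : V, Functor (bhom X Y) E;
  ap_faithful : forall (X Y : V) (S T : bhom X Y) (f g : hom S T),
    fmap (ap X Y) f = fmap (ap X Y) g -> f = g;
  pl : forall (X Y Z : V) (T : bhom Y Z) (S : bhom X Y),
    hom (ap X Z (T ⊗ S)) (ap X Y S);
  pr : forall (X Y Z : V) (T : bhom Y Z) (S : bhom X Y),
    hom (ap X Z (T ⊗ S)) (ap Y Z T);
  p_eq : forall (X Y Z : V) (T : bhom Y Z) (S : bhom X Y) (x : E)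
    (h k : hom x (ap X Z (T ⊗ S))),
    pl T S ∘ h = pl T S ∘ k -> pr T S ∘ h = pr T S ∘ k -> h = k;
  pl_tens2 : forall (X Y Z : V) (T T' : bhom Y Z) (S S' : bhom X Y)
    (b : hom T T') (a : hom S S'),
    pl T' S' ∘ fmap (ap X Z) (b ⊗⊗ a) = fmap (ap X Y) a ∘ pl T S;
  pr_tens2 : forall (X Y Z : V) (T T' : bhom Y Z) (S S' : bhom X Y)
    (b : hom T T') (a : hom S S'),
    pr T' S' ∘ fmap (ap X Z) (b ⊗⊗ a) = fmap (ap Y Z) b ∘ pr T S;
  ap_lun : forall (X Y : V) (S : bhom X Y), fmap (ap X Y) (lun S) = pl (bid Y) S;
  ap_run : forall (X Y : V) (S : bhom X Y), fmap (ap X Y) (run S) = pr S (bid X);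
  pl_pl_assoc : forall (X Y Z U : V) (R : bhom Z U) (T : bhom Y Z) (S : bhom X Y),
    pl T S ∘ pl R (T ⊗ S) ∘ fmap (ap X U) (assoc R T S) = pl (R ⊗ T) S;
  pr_pl_assoc : forall (X Y Z U : V) (R : bhom Z U) (T : bhom Y Z) (S : bhom X Y),
    pr T S ∘ pl R (T ⊗ S) ∘ fmap (ap X U) (assoc R T S) = pl R T ∘ pr (R ⊗ T) S;
  pr_assoc : forall (X Y Z U : V) (R : bhom Z U) (T : bhom Y Z) (S : bhom X Y),
    pr R (T ⊗ S) ∘ fmap (ap X U) (assoc R T S) = pr R T ∘ pr (R ⊗ T) S }.
Arguments ap {E V} _ {X Y}.
Arguments pl {E V} _ {X Y Z} T S.
Arguments pr {E V} _ {X Y Z} T S.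

Section SpanLikeTheory.
Variables (E : Category) (V : Bicategory) (L : SpanLike E V).

Section Tens2.
Variables (X Y Z : V) (T T' : bhom Y Z) (S S' : bhom X Y) (b : hom T T') (a : hom S S')
  (x : E) (z : hom x (ap L (T ⊗ S))).

Lemma pl_tens2A :
  pl L T' S' ∘ fmap (ap L) (b ⊗⊗ a) ∘ z = fmap (ap L) a ∘ pl L T S ∘ z.
Proof. exact: ch22 (pl_tens2 L b a). Qed.

Lemma pr_tens2A :
  pr L T' S' ∘ fmap (ap L) (b ⊗⊗ a) ∘ z = fmap (ap L) b ∘ pr L T S ∘ z.
Proof. exact: ch22 (pr_tens2 L b a). Qed.
End Tens2.

Section Assoc.
Variables (X Y Z U : V) (R : bhom Z U) (T : bhom Y Z) (S : bhom X Y)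
  (x : E) (z : hom x (ap L (R ⊗ T ⊗ S))).

Lemma pl_pl_assocA :
  pl L T S ∘ pl L R (T ⊗ S) ∘ fmap (ap L) (assoc R T S) ∘ z = pl L (R ⊗ T) S ∘ z.
Proof. by rewrite -(pl_pl_assoc L) !comp_assoc. Qed.

Lemma pr_pl_assocA :
  pr L T S ∘ pl L R (T ⊗ S) ∘ fmap (ap L) (assoc R T S) ∘ z
  = pl L R T ∘ pr L (R ⊗ T) S ∘ z.
Proof. exact: ch32 (pr_pl_assoc L R T S). Qed.

Lemma pr_assocA :
  pr L R (T ⊗ S) ∘ fmap (ap L) (assoc R T S) ∘ z = pr L R T ∘ pr L (R ⊗ T) S ∘ z.
Proof. exact: ch22 (pr_assoc L R T S). Qed.
End Assoc.
End SpanLikeTheory.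

(** Gives both sides a tail, so that only the rewriting rules with a trailing morphism are
    needed. *)
Ltac norm_idr := match goal with |- ?l = ?r => rewrite -(comp_idr l) -(comp_idr r) end.

(** * Morphisms and enriched functors controlled by frames *)

Section Framed.
Variables (E : Category) (W V : Bicategory) (K : SpanLike E W) (L : SpanLike E V).

Section Build.
Variables (mo : W -> V -> Type)
  (mh : forall w w' v v' (A : mo w v) (A' : mo w' v'),
     Functor (bhom w w') (bhom v v'))
  (mm : forall w w' w'' v v' v'' (A : mo w v) (A' : mo w' v')
     (A'' : mo w'' v'') (f' : bhom w' w'') (f : bhom w w'),
     hom (mh A' A'' f' ⊗ mh A A' f) (mh A A'' (f' ⊗ f)))
  (me : forall w v (A : mo w v), hom (bid v) (mh A A (bid w)))
  (fr : forall w w' v v' (A : mo w v) (A' : mo w' v') (f : bhom w w'),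
     hom (ap L (mh A A' f)) (ap K f)).

(** [fr] identifies the apices of [mh A A' f] and [f] compatibly with the
    projections.  The Morphism laws, the laws of enriched functors compatible
    with frames, and the equality of parallel such functors all follow. *)
Definition framed :=
  (forall w w' v v' (A : mo w v) (A' : mo w' v') (f : bhom w w'), Mono (fr A A' f)) /\
  (forall w w' v v' (A : mo w v) (A' : mo w' v') (f g : bhom w w') (a : hom f g),
     fr A A' g ∘ fmap (ap L) (fmap (mh A A') a) = fmap (ap K) a ∘ fr A A' f) /\
  (forall w w' w'' v v' v'' (A : mo w v) (A' : mo w' v') (A'' : mo w'' v'')
     (f' : bhom w' w'') (f : bhom w w'),
     pl K f' f ∘ fr A A'' (f' ⊗ f) ∘ fmap (ap L) (mm A A' A'' f' f)
     = fr A A' f ∘ pl L (mh A' A'' f') (mh A A' f)) /\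
  (forall w w' w'' v v' v'' (A : mo w v) (A' : mo w' v') (A'' : mo w'' v'')
     (f' : bhom w' w'') (f : bhom w w'),
     pr K f' f ∘ fr A A'' (f' ⊗ f) ∘ fmap (ap L) (mm A A' A'' f' f)
     = fr A' A'' f' ∘ pr L (mh A' A'' f') (mh A A' f)).

Hypothesis H : framed.

Lemma fr_mono w w' v v' (A : mo w v) (A' : mo w' v') (f : bhom w w') : Mono (fr A A' f).
Proof. by case: H => [m _]; apply: m. Qed.

Lemma fr_nat w w' v v' (A : mo w v) (A' : mo w' v') (f g : bhom w w') (a : hom f g)
  x (z : hom x _) :
  fr A A' g ∘ fmap (ap L) (fmap (mh A A') a) ∘ z = fmap (ap K) a ∘ fr A A' f ∘ z.
Proof. by case: H => [_ [n _]]; exact: ch22 (n _ _ _ _ _ _ _ _ _). Qed.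

Lemma fr_mul w w' w'' v v' v'' (A : mo w v) (A' : mo w' v') (A'' : mo w'' v'')
     (f' : bhom w' w'') (f : bhom w w') x (z : hom x _) :
     pl K f' f ∘ fr A A'' (f' ⊗ f) ∘ fmap (ap L) (mm A A' A'' f' f) ∘ z
     = fr A A' f ∘ pl L (mh A' A'' f') (mh A A' f) ∘ z.
Proof. by case: H => [_ [_ [n _]]]; exact: ch32 (n _ _ _ _ _ _ _ _ _ _ _). Qed.

Lemma fr_mur w w' w'' v v' v'' (A : mo w v) (A' : mo w' v') (A'' : mo w'' v'')
     (f' : bhom w' w'') (f : bhom w w') x (z : hom x _) :
     pr K f' f ∘ fr A A'' (f' ⊗ f) ∘ fmap (ap L) (mm A A' A'' f' f) ∘ z
     = fr A' A'' f' ∘ pr L (mh A' A'' f') (mh A A' f) ∘ z.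
Proof. by case: H => [_ [_ [_ n]]]; exact: ch32 (n _ _ _ _ _ _ _ _ _ _ _). Qed.

(** Pushes frames towards the source, across images of 2-cells and the multiplication, and evaluates
    the projections met on the way. *)
Ltac fr_simp := norm_idr; rewrite ?fmap_comp ?comp_assoc;
  repeat first
    [ rewrite comp_assoc | rewrite fmap_id | rewrite comp_idl
    | rewrite fr_nat | rewrite fr_mul | rewrite fr_mur | rewrite pl_tens2A | rewrite pr_tens2A
    | rewrite pl_pl_assocA | rewrite pr_pl_assocA | rewrite pr_assocA
    | rewrite ap_lun | rewrite ap_run ].

(** Faithful apices, monic frames and jointly monic projections turn each law into an equation of
    projections. In the unit laws, [lun] and [run] become the projection away from the factor
    holding [me]. *)
Definition framed_morphism : Morphism W V.
Proof.
refine {| mob := mo; mhom := mh; mmu := mm; meta := me |}.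
- move=> w w' w'' v v' v'' A A' A'' f' g' f g b a.
  by apply: (ap_faithful (s := L)); apply: fr_mono; apply: (p_eq (s := K)); fr_simp.
- move=> w w' w'' w''' v v' v'' v''' A A' A'' A''' h g f.
  (* A map into [h ⊗ (g ⊗ f)] is determined by three projections, so the left factor is split once
     more. *)
  apply: (ap_faithful (s := L)); apply: fr_mono; apply: (p_eq (s := K));
    [apply: (p_eq (s := K))|]; by fr_simp.
- move=> w w' v v' A A' f.
  by apply: (ap_faithful (s := L)); apply: fr_mono; fr_simp.
- move=> w w' v v' A A' f.
  by apply: (ap_faithful (s := L)); apply: fr_mono; fr_simp.
Defined.
End Build.

Definition Frame (A : Morphism W V) := forall w w' v v' (X : mob A w v) (X' : mob A w' v')
  (f : bhom w w'), hom (ap L (mhom A X X' f)) (ap K f).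

Section Equivalence.
Variables (A B : Morphism W V) (frA : Frame A) (frB : Frame B).
Hypotheses (HA : framed (@mmu _ _ A) frA) (HB : framed (@mmu _ _ B) frB).

Section Enriched.
Variables (F : forall w v, mob A w v -> mob B w v)
  (phi : forall w w' v v' (X : mob A w v) (X' : mob A w' v') (f : bhom w w'),
     hom (mhom A X X' f) (mhom B (F X) (F X') f)).
Hypothesis frphi : forall w w' v v' (X : mob A w v) (X' : mob A w' v') (f : bhom w w'),
  frB (F X) (F X') f ∘ fmap (ap L) (phi X X' f) = frA X X' f.
Hypothesis freta : forall w v (X : mob A w v),
  frA X X (bid w) ∘ fmap (ap L) (meta A X)
  = frB (F X) (F X) (bid w) ∘ fmap (ap L) (meta B (F X)).

Lemma frphiA w w' v v' (X : mob A w v) (X' : mob A w' v') (f : bhom w w') x (z : hom x _) :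
  frB (F X) (F X') f ∘ fmap (ap L) (phi X X' f) ∘ z = frA X X' f ∘ z.
Proof. exact: ch21 (frphi _ _ _). Qed.

(** After composition with the monic [frB], [phi] disappears and only the frame conditions of [A]
    and [B] are compared. Since [framed] says nothing about unit cells, [freta] is assumed
    separately. *)
Definition framed_enriched : EnrichedFunctor A B.
Proof.
refine {| efob := F; efhom := phi |}.
- move=> w w' v v' X X' f g a; apply: (ap_faithful (s := L)); apply: (fr_mono HB).
  norm_idr; rewrite !fmap_comp !comp_assoc.
  by rewrite frphiA (fr_nat HA) (fr_nat HB) frphiA.
- move=> w w' w'' v v' v'' X X' X'' f' f.
  apply: (ap_faithful (s := L)); apply: (fr_mono HB); apply: (p_eq (s := K));
    norm_idr; rewrite !fmap_comp !comp_assoc frphiA.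
  + by rewrite (fr_mul HA) (fr_mul HB) pl_tens2A frphiA.
  + by rewrite (fr_mur HA) (fr_mur HB) pr_tens2A frphiA.
- move=> w v X; apply: (ap_faithful (s := L)); apply: (fr_mono HB).
  by rewrite fmap_comp frphiA freta.
Defined.
End Enriched.

(** A 2-cell over the monic frame [frB] is unique, so agreement on objects forces agreement on homs
    up to transport. *)
Lemma framed_Iso3 (F H : EnrichedFunctor A B) :
  (forall w w' v v' (X : mob A w v) (X' : mob A w' v') (f : bhom w w'),
    frB (F _ _ X) (F _ _ X') f ∘ fmap (ap L) (efhom F X X' f) = frA X X' f) ->
  (forall w w' v v' (X : mob A w v) (X' : mob A w' v') (f : bhom w w'),
    frB (H _ _ X) (H _ _ X') f ∘ fmap (ap L) (efhom H X X' f) = frA X X' f) ->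
  (forall w v (X : mob A w v), efob F X = efob H X) -> Iso3 F H.
Proof.
move=> hF hH e; apply: (Iso3_cast (e := e)) => w w' v v' X X' f.
apply: (ap_faithful (s := L)); apply: (fr_mono HB); rewrite hH -hF.
by case: _ / (e w v X); case: _ / (e w' v' X').
Qed.
End Equivalence.

(** Composites and identities are compatible with the frames, so [framed_Iso3] compares them; that
    [phi] and [chi] invert each other follows from the monic frames. *)
Lemma framed_equivalent (A B : Morphism W V) (frA : Frame A) (frB : Frame B)
  (HA : framed (@mmu _ _ A) frA) (HB : framed (@mmu _ _ B) frB)
  (F : forall w v, mob A w v -> mob B w v) (H : forall w v, mob B w v -> mob A w v)
  (phi : forall w w' v v' (X : mob A w v) (X' : mob A w' v') (f : bhom w w'),
     hom (mhom A X X' f) (mhom B (F _ _ X) (F _ _ X') f))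
  (chi : forall w w' v v' (X : mob B w v) (X' : mob B w' v') (f : bhom w w'),
     hom (mhom B X X' f) (mhom A (H _ _ X) (H _ _ X') f)) :
  (forall w w' v v' (X : mob A w v) (X' : mob A w' v') (f : bhom w w'),
    frB _ _ _ _ (F _ _ X) (F _ _ X') f ∘ fmap (ap L) (phi _ _ _ _ X X' f)
    = frA _ _ _ _ X X' f) ->
  (forall w w' v v' (X : mob B w v) (X' : mob B w' v') (f : bhom w w'),
    frA _ _ _ _ (H _ _ X) (H _ _ X') f ∘ fmap (ap L) (chi _ _ _ _ X X' f)
    = frB _ _ _ _ X X' f) ->
  (forall w v (X : mob A w v),
    frA _ _ _ _ X X (bid w) ∘ fmap (ap L) (meta A X)
    = frB _ _ _ _ (F _ _ X) (F _ _ X) (bid w) ∘ fmap (ap L) (meta B (F _ _ X))) ->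
  (forall w v (X : mob A w v), H _ _ (F _ _ X) = X) ->
  (forall w v (X : mob B w v), F _ _ (H _ _ X) = X) ->
  EquivalentMorphisms A B.
Proof.
move=> hphi hchi heta HF FH.
have heta' w v (X : mob B w v) : frB _ _ _ _ X X (bid w) ∘ fmap (ap L) (meta B X)
    = frA _ _ _ _ (H _ _ X) (H _ _ X) (bid w) ∘ fmap (ap L) (meta A (H _ _ X)).
  by rewrite heta FH.
exists (framed_enriched HA HB hphi heta), (framed_enriched HB HA hchi heta').
split.
- apply: (framed_Iso3 (frA := frA) HA) => //= w w' v v' X X' f.
  + by rewrite fmap_comp -comp_assoc hchi hphi.
  + by rewrite fmap_id comp_idr.
- apply: (framed_Iso3 (frA := frB) HB) => //= w w' v v' X X' f.
  + by rewrite fmap_comp -comp_assoc hphi hchi.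
  + by rewrite fmap_id comp_idr.
Qed.
End Framed.

(** * Frames on identities and composites *)

Section FramedComp.
Variables (E : Category) (W V U : Bicategory)
  (K : SpanLike E W) (L : SpanLike E V) (M : SpanLike E U).

Definition id_frame (w w' v v' : W) (X : mob (IdMorphism W) w v)
  (X' : mob (IdMorphism W) w' v') (f : bhom w w') : hom (ap K (mhom _ X X' f)) (ap K f) :=
  match X in IdOb w v, X' in IdOb w' v'
    return forall f : bhom w w', hom (ap K (mhom (IdMorphism W) X X' f)) (ap K f) with
  | idob w, idob w' => fun f => idm (ap K f)
  end f.

Lemma id_framed : framed (@mmu _ _ (IdMorphism W)) id_frame.
Proof.
split; [|split; [|split]].
- by move=> w w' v v' [{}w] [{}w'] f x h k /=; rewrite !comp_idl.
- by move=> w w' v v' [{}w] [{}w'] f g a /=; rewrite comp_idl comp_idr.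
- move=> w w' w'' v v' v'' [{}w] [{}w'] [{}w''] f' f /=.
  by rewrite fmap_id comp_idl !comp_idr comp_idl.
- move=> w w' w'' v v' v'' [{}w] [{}w'] [{}w''] f' f /=.
  by rewrite fmap_id comp_idl !comp_idr comp_idl.
Qed.

Variables (A : Morphism W V) (B : Morphism V U) (frA : Frame K L A) (frB : Frame L M B).
Hypotheses (HA : framed (@mmu _ _ A) frA) (HB : framed (@mmu _ _ B) frB).

Definition comp_frame : Frame K M (CompMorphism B A) := fun w w' v v' X X' f =>
  frA (fst (projT2 X)) (fst (projT2 X')) f ∘ frB (snd (projT2 X)) (snd (projT2 X')) _.

(** The multiplication of the composite contains the image under [B] of that of [A]; naturality of
    [frB] turns this image into the multiplication of [A] itself, and the two frame conditions then
    apply in turn. *)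
Lemma comp_framed : framed (@mmu _ _ (CompMorphism B A)) comp_frame.
Proof.
split; [|split; [|split]]; rewrite /comp_frame.
- move=> w w' v v' X X' f x h k; rewrite !comp_assoc => e.
  exact: (fr_mono HB (fr_mono HA e)).
- move=> w w' v v' X X' f g a /=; norm_idr; rewrite !comp_assoc.
  by rewrite (fr_nat HB) (fr_nat HA).
- move=> w w' w'' v v' v'' X X' X'' f' f /=; norm_idr; rewrite !fmap_comp !comp_assoc.
  by rewrite (fr_nat HB) (fr_mul HA) (fr_mul HB).
- move=> w w' w'' v v' v'' X X' X'' f' f /=; norm_idr; rewrite !fmap_comp !comp_assoc.
  by rewrite (fr_nat HB) (fr_mur HA) (fr_mur HB).
Qed.
End FramedComp.

(** * Apex functors for spans and for bicategories of coalgebras *)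

Section Instances.
Variables (E : Category).

(** [H] will be the identity for spans in [E] and the forgetful functor for spans of coalgebras.
    Joint monicity is asked in [E], where test objects need not come from [C]. *)
Definition Spn_span_like (C : Category) (PB : HasPullbacks C) (H : Functor C E)
  (faithful : forall (a b : C) (f g : hom a b), fmap H f = fmap H g -> f = g)
  (jointly_monic : forall (a b c : C) (f : hom a c) (g : hom b c) x
     (h k : hom x (H (PB _ _ _ f g))),
     fmap H (pbl _) ∘ h = fmap H (pbl _) ∘ k ->
     fmap H (pbr _) ∘ h = fmap H (pbr _) ∘ k -> h = k) : SpanLike E (Spn PB).
Proof.
unshelve refine {| ap := fun X Y : Spn PB => {| fob := fun S : bhom X Y => H (apex S);
    fmap := fun S T (f : hom S T) => fmap H (shm f) |};
  pl := fun X Y Z T S => fmap H (tl PB T S);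
  pr := fun X Y Z T S => fmap H (tr PB T S) |}.
- by move=> S; rewrite fmap_id.
- by move=> R S T g f; rewrite -fmap_comp.
- by move=> X Y S T f g e; apply: shm_eq; apply: faithful.
- by move=> X Y Z T S x h k; apply: jointly_monic.
- by move=> X Y Z T T' S S' b a; rewrite /= -!fmap_comp tl_tens2.
- by move=> X Y Z T T' S S' b a; rewrite /= -!fmap_comp tr_tens2.
- by [].
- by [].
- by move=> X Y Z U R T S; rewrite /= -!fmap_comp tl_tl_assoc.
- by move=> X Y Z U R T S; rewrite /= -!fmap_comp tr_tl_assoc.
- by move=> X Y Z U R T S; rewrite /= -!fmap_comp tr_assoc.
Defined.

Definition EM_forget (C : Category) (G : Comonad C) : Functor (EM G) C.
Proof. by refine {| fob := fun X : EM G => carrier X; fmap := fun X Y f => cohom f |}. Defined.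

(** The tensor and coherence cells of [EMBicat K] are those of [V], so each condition is inherited
    from [L]. *)
Definition EMBicat_span_like (V : Bicategory) (L : SpanLike E V) (K : CatenComonad V) :
  SpanLike E (EMBicat K).
Proof.
refine {| ap := fun X Y : EMBicat K =>
    CompFunctor (@ap _ _ L (cob0 X) (cob0 Y)) (EM_forget (chom K X Y));
  pl := fun X Y Z T S => pl L (carrier T) (carrier S);
  pr := fun X Y Z T S => pr L (carrier T) (carrier S) |}.
- by move=> X Y S T f g e; apply: cohom_eq; apply: (ap_faithful e).
- by move=> X Y Z T S x h k; apply: p_eq.
- by move=> X Y Z T T' S S' b a; apply: pl_tens2.
- by move=> X Y Z T T' S S' b a; apply: pr_tens2.
- by move=> X Y S; apply: ap_lun.
- by move=> X Y S; apply: ap_run.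
- by move=> X Y Z U R T S; apply: pl_pl_assoc.
- by move=> X Y Z U R T S; apply: pr_pl_assoc.
- by move=> X Y Z U R T S; apply: pr_assoc.
Defined.
End Instances.

(** Conversion must not unfold these categories: it would compare the proofs
    of their laws. *)
Strategy 1000 [EM SpanCat gconj_comonad].

(** * Coactions on spans and spans of coalgebras *)

Section LocalComparison.
Variables (E : Category) (PB : HasPullbacks E) (G : Comonad E)
  (HG : PreservesPullbacks G).
Notation EW X X' := (EM (gconj_comonad PB HG X X')).
Notation EV X X' := (@SpanCat (EM G) X X').

Section Phi.
Variables X X' : Coalgebra G.

Definition apex_act (S : EW X X') : hom (apex (carrier S)) (G (apex (carrier S))) :=
  @gS E PB G X X' (carrier S) ∘ shm (coact S).

(** The legs of [gconj] are the outer projections of the limit, and a coaction, being a 2-cell,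
    preserves legs. *)
Lemma apex_act_l (S : EW X X') :
  fmap G (lleg (carrier S)) ∘ apex_act S = coact X ∘ lleg (carrier S).
Proof.
rewrite /apex_act -comp_assoc -(zz_comml (gconj_zigzag PB _)) comp_assoc.
by rewrite -lleg_gconj (shm_l (coact S)).
Qed.

Lemma apex_act_r (S : EW X X') :
  fmap G (rleg (carrier S)) ∘ apex_act S = coact X' ∘ rleg (carrier S).
Proof.
rewrite /apex_act -comp_assoc (zz_commr (gconj_zigzag PB _)) comp_assoc.
by rewrite -rleg_gconj (shm_r (coact S)).
Qed.

(** Seen through [gS], the counit and comultiplication of the hom comonad are [eps G] and [delta G],
    so the laws of the coaction on [S] become coalgebra laws in [E]. *)
Definition Phi_apex (S : EW X X') : Coalgebra G.
Proof.
refine {| carrier := apex (carrier S); coact := apex_act S |}.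
- rewrite /apex_act -comp_assoc -shm_geps.
  exact: (f_equal (@shm _ _ _ _ _) (coact_eps S)).
- have e : shm (gdelta HG (carrier S)) ∘ shm (coact S)
    = shm (@gconj2 E PB G X X' _ _ (coact S)) ∘ shm (coact S)
    := f_equal (@shm _ _ _ _ _) (coact_delta S).
  by rewrite -comp_assoc -(gS_gdelta HG) !comp_assoc e gS_gconj2A -comp_assoc -fmap_comp.
Defined.

Definition Phi_ob (S : EW X X') : EV X X' :=
  @Build_Span (EM G) X X' (Phi_apex S)
    (@Build_CoalgebraHom E G (Phi_apex S) X (lleg (carrier S)) (eq_sym (apex_act_l S)))
    (@Build_CoalgebraHom E G (Phi_apex S) X' (rleg (carrier S)) (eq_sym (apex_act_r S))).

Lemma apex_act_nat (S T : EW X X') (f : hom S T) :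
  apex_act T ∘ shm (cohom f) = fmap G (shm (cohom f)) ∘ apex_act S.
Proof.
have e : shm (coact T) ∘ shm (cohom f)
  = shm (@gconj2 E PB G X X' _ _ (cohom f)) ∘ shm (coact S)
  := f_equal (@shm _ _ _ _ _) (cohomP f).
by rewrite /apex_act comp_assoc e -!comp_assoc gS_gconj2.
Qed.

Definition Phi_hom (S T : EW X X') (f : hom S T) : hom (Phi_ob S) (Phi_ob T).
Proof.
refine (@Build_SpanHom (EM G) X X' (Phi_ob S) (Phi_ob T)
  (@Build_CoalgebraHom E G (Phi_apex S) (Phi_apex T) (shm (cohom f)) (apex_act_nat f)) _ _);
  apply: cohom_eq; [exact: shm_l | exact: shm_r].
Defined.

Definition Phi : Functor (EW X X') (EV X X').
Proof.
by refine {| fob := Phi_ob; fmap := Phi_hom |} => *; apply: shm_eq; apply: cohom_eq.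
Defined.

Definition forget_span (T : EV X X') : @SpanCat E X X' :=
  {| apex := carrier (apex T) : E; lleg := cohom (lleg T); rleg := cohom (rleg T) |}.

Definition forget_hom (S T : EV X X') (f : hom S T) :
  hom (forget_span S) (forget_span T).
Proof.
refine (@Build_SpanHom E X X' (forget_span S) (forget_span T) (cohom (shm f)) _ _).
- exact: (f_equal (@cohom _ _ _ _) (shm_l f)).
- exact: (f_equal (@cohom _ _ _ _) (shm_r f)).
Defined.

(** That both legs are coalgebra morphisms says exactly that the legs and the coaction form a cone
    over the limit diagram. *)
Definition Psi_act_map (T : EV X X') :
  hom (apex (forget_span T)) (apex (@gconj E PB G X X' (forget_span T))) :=
  zz_lift (gconj_zigzag PB (forget_span T)) (cohomP (lleg T)) (eq_sym (cohomP (rleg T))).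

Definition Psi_act (T : EV X X') : hom (forget_span T) (@gconj E PB G X X' (forget_span T)).
Proof.
refine (@Build_SpanHom E X X' (forget_span T) (@gconj E PB G X X' (forget_span T))
  (Psi_act_map T) _ _).
- by rewrite lleg_gconj zz_liftA.
- by rewrite rleg_gconj zz_liftA'.
Defined.

Lemma gS_Psi_act (T : EV X X') :
  @gS E PB G X X' (forget_span T) ∘ shm (Psi_act T) = coact (apex T).
Proof. exact: zz_liftS. Qed.

Definition Psi_ob (T : EV X X') : EW X X'.
Proof.
refine (@Build_Coalgebra _ (gconj_comonad PB HG X X') (forget_span T) (Psi_act T) _ _).
- apply: shm_eq; rewrite shm_comp shm_geps comp_assoc gS_Psi_act; exact: coact_eps.
(* Maps into the iterated [gconj] may be tested after the monic [gS] followed by the monic image of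
   [gS] under [G]. *)
- apply: shm_eq; apply: gS_mono; apply: (G_gS_mono HG).
  rewrite !shm_comp gS_gdeltaA gS_gconj2A gS_Psi_act.
  rewrite -(comp_assoc (fmap G (gS _))) -fmap_comp gS_Psi_act.
  exact: coact_delta.
Defined.

Lemma apex_act_Psi (T : EV X X') : apex_act (Psi_ob T) = coact (apex T).
Proof. exact: gS_Psi_act. Qed.

(** With [EW_hom], builds the isomorphisms and constraints below from 2-cells of spans in [E],
    leaving only compatibility with the apex coactions. *)
Definition EV_hom (S T : EV X X') (h : hom (forget_span S) (forget_span T))
  (c : coact (apex T) ∘ shm h = fmap G (shm h) ∘ coact (apex S)) : hom S T.
Proof.
refine (@Build_SpanHom (EM G) X X' S T
  (@Build_CoalgebraHom E G (apex S) (apex T) (shm h) c) _ _);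
  apply: cohom_eq; [exact: (shm_l h) | exact: (shm_r h)].
Defined.

(** The coalgebra condition is an equation into [gconj T]; the monic [gS] reduces it to [c]. *)
Definition EW_hom (S T : EW X X') (h : hom (carrier S) (carrier T))
  (c : apex_act T ∘ shm h = fmap G (shm h) ∘ apex_act S) : hom S T.
Proof.
refine (@Build_CoalgebraHom _ (gconj_comonad PB HG X X') S T h _).
apply: shm_eq; apply: gS_mono.
by rewrite !shm_comp gS_gconj2A; move: c; rewrite /apex_act comp_assoc.
Defined.

Lemma EW_eq (S T : EW X X') (f g : hom S T) :
  shm (cohom f) = shm (cohom g) -> f = g.
Proof. by move=> e; apply: cohom_eq; apply: shm_eq. Qed.

Definition Psi_hom (S T : EV X X') (f : hom S T) : hom (Psi_ob S) (Psi_ob T).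
Proof.
refine (@EW_hom (Psi_ob S) (Psi_ob T) (forget_hom f) _).
rewrite !apex_act_Psi; exact: (cohomP (shm f)).
Defined.

Definition Psi : Functor (EV X X') (EW X X').
Proof. by refine {| fob := Psi_ob; fmap := Psi_hom |} => *; apply: EW_eq. Defined.

(** The two coactions agree only through [apex_act_Psi], so the round trip is handled as an
    isomorphism with identity apex. *)
Definition Phi_Psi_iso (T : EV X X') : hom (Phi_ob (Psi_ob T)) T.
Proof.
refine (@EV_hom (Phi_ob (Psi_ob T)) T (idm (forget_span T)) _).
rewrite shm_id fmap_id comp_idl comp_idr; exact: eq_sym (apex_act_Psi T).
Defined.

Definition Phi_Psi_iso_inv (T : EV X X') : hom T (Phi_ob (Psi_ob T)).
Proof.
refine (@EV_hom T (Phi_ob (Psi_ob T)) (idm (forget_span T)) _).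
rewrite shm_id fmap_id comp_idl comp_idr; exact: apex_act_Psi.
Defined.

Definition Psi_Phi_iso (S : EW X X') : hom (Psi_ob (Phi_ob S)) S.
Proof.
refine (@EW_hom (Psi_ob (Phi_ob S)) S
  (@Build_SpanHom E X X' (forget_span (Phi_ob S)) (carrier S) (idm (apex (carrier S)))
     (comp_idr _) (comp_idr _)) _).
by rewrite apex_act_Psi /= fmap_id comp_idl comp_idr.
Defined.

Definition Psi_Phi_iso_inv (S : EW X X') : hom S (Psi_ob (Phi_ob S)).
Proof.
refine (@EW_hom S (Psi_ob (Phi_ob S))
  (@Build_SpanHom E X X' (carrier S) (forget_span (Phi_ob S)) (idm (apex (carrier S)))
     (comp_idr _) (comp_idr _)) _).
by rewrite apex_act_Psi /= fmap_id comp_idl comp_idr.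
Defined.
End Phi.

(** * Comparison constraints for composites, for any chosen pullbacks of coalgebras *)

Section Tens.
Variables X X' X'' : Coalgebra G.

Variable PB' : HasPullbacks (EM G).
Notation etens T S := (@emb_tens _ (SpnComonad PB HG) _ _ _ T S).
Notation vtens T S := (@sp_tens (EM G) PB' _ _ _ T S).
Notation gc Y Y' := (@gconj E PB G Y Y').

Section Act.
Variables (T : @SpanCat E X' X'') (S : @SpanCat E X X').
Variables (t : hom T (gc X' X'' T)) (s : hom S (gc X X' S)).

(** Taken for plain 2-cells into [gconj]; for coalgebras it is the apex coaction of the composite,
    by [apex_act_tens]. *)
Definition tens_act : hom (apex (sp_tens PB T S)) (G (apex (sp_tens PB T S))) :=
  @gS E PB G X X'' (sp_tens PB T S) ∘ shm (gmu HG T S) ∘ shm (sp_tens2 PB t s).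

(** Both [gmu] and [sp_tens2] commute with the projections, hence the projections of the composite
    respect the coactions. *)
Lemma tl_tens_act :
  fmap G (tl PB T S) ∘ tens_act = (@gS E PB G X X' S ∘ shm s) ∘ tl PB T S.
Proof.
by rewrite /tens_act (ch32 _ (tl_gmu HG T S)) tl_tens2 comp_assoc.
Qed.

Lemma tr_tens_act :
  fmap G (tr PB T S) ∘ tens_act = (@gS E PB G X' X'' T ∘ shm t) ∘ tr PB T S.
Proof.
by rewrite /tens_act (ch32 _ (tr_gmu HG T S)) tr_tens2 comp_assoc.
Qed.

(** [G] preserves the pullback, so an equation into its image may be tested on the images of the two
    projections, where [tl_tens_act] and [tr_tens_act] apply. *)
Lemma tens_act_lift (Z : Coalgebra G) (h : hom (carrier Z) (apex S))
  (k : hom (carrier Z) (apex T)) (e : rleg S ∘ h = lleg T ∘ k) :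
  (@gS E PB G X X' S ∘ shm s) ∘ h = fmap G h ∘ coact Z ->
  (@gS E PB G X' X'' T ∘ shm t) ∘ k = fmap G k ∘ coact Z ->
  tens_act ∘ tlift PB e = fmap G (tlift PB e) ∘ coact Z.
Proof.
move=> eh ek; apply: (G_tens_eq HG); rewrite -[RHS]comp_assoc -fmap_comp.
- by rewrite (ch22 _ tl_tens_act) tl_lift.
- by rewrite (ch22 _ tr_tens_act) tr_lift.
Qed.
End Act.

Lemma coact_tens (T : EW X' X'') (S : EW X X') :
  coact (etens T S)
  = @comp (@SpanCat E X X'') _ _ _ (gmu HG (carrier T) (carrier S))
      (sp_tens2 PB (coact T) (coact S)).
Proof. by cbn [coact emb_tens SpnComonad cmu]. Qed.

Lemma apex_act_tens (T : EW X' X'') (S : EW X X') :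
  apex_act (etens T S) = tens_act (coact T) (coact S).
Proof. by rewrite /apex_act coact_tens. Qed.

Section PhiMu.
Variables (T : EW X' X'') (S : EW X X').

Lemma Phi_mu_subproof :
  rleg (carrier S) ∘ cohom (tl PB' (Phi_ob T) (Phi_ob S))
  = lleg (carrier T) ∘ cohom (tr PB' (Phi_ob T) (Phi_ob S)).
Proof. exact: (f_equal (@cohom _ _ _ _) (t_comm PB' (Phi_ob T) (Phi_ob S))). Qed.

Definition Phi_mu_span : hom (forget_span (vtens (Phi_ob T) (Phi_ob S)))
  (sp_tens PB (carrier T) (carrier S)).
Proof.
refine (@Build_SpanHom E X X'' (forget_span (vtens (Phi_ob T) (Phi_ob S)))
   (sp_tens PB (carrier T) (carrier S)) (tlift PB Phi_mu_subproof) _ _).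
- by rewrite lleg_tens comp_assoc tl_lift.
- by rewrite rleg_tens comp_assoc tr_lift.
Defined.

Lemma Phi_mu_act : tens_act (coact T) (coact S) ∘ tlift PB Phi_mu_subproof
  = fmap G (tlift PB Phi_mu_subproof) ∘ coact (apex (vtens (Phi_ob T) (Phi_ob S))).
Proof.
exact: (@tens_act_lift _ _ (coact T) (coact S) (apex (vtens (Phi_ob T) (Phi_ob S))) _ _
  Phi_mu_subproof (cohomP (tl PB' (Phi_ob T) (Phi_ob S)))
  (cohomP (tr PB' (Phi_ob T) (Phi_ob S)))).
Qed.

Definition Phi_mu : hom (vtens (Phi_ob T) (Phi_ob S)) (Phi_ob (etens T S)).
Proof.
refine (@EV_hom _ _ (vtens (Phi_ob T) (Phi_ob S)) (Phi_ob (etens T S)) Phi_mu_span _).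
change (apex_act (etens T S) ∘ tlift PB Phi_mu_subproof
  = fmap G (tlift PB Phi_mu_subproof) ∘ coact (apex (vtens (Phi_ob T) (Phi_ob S)))).
by rewrite apex_act_tens Phi_mu_act.
Defined.

Lemma tl_Phi_mu : tl PB (carrier T) (carrier S) ∘ shm (forget_hom Phi_mu)
  = cohom (tl PB' (Phi_ob T) (Phi_ob S)).
Proof. exact: tl_lift. Qed.

Lemma tr_Phi_mu : tr PB (carrier T) (carrier S) ∘ shm (forget_hom Phi_mu)
  = cohom (tr PB' (Phi_ob T) (Phi_ob S)).
Proof. exact: tr_lift. Qed.
End PhiMu.

Section PsiMu.
Variables (T : EV X' X'') (S : EV X X').

Lemma Psi_mu_subproof1 : coact (apex S) ∘ tl PB (forget_span T) (forget_span S)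
  = fmap G (tl PB (forget_span T) (forget_span S)) ∘ apex_act (etens (Psi_ob T) (Psi_ob S)).
Proof. by rewrite apex_act_tens tl_tens_act gS_Psi_act. Qed.

Lemma Psi_mu_subproof2 : coact (apex T) ∘ tr PB (forget_span T) (forget_span S)
  = fmap G (tr PB (forget_span T) (forget_span S)) ∘ apex_act (etens (Psi_ob T) (Psi_ob S)).
Proof. by rewrite apex_act_tens tr_tens_act gS_Psi_act. Qed.

Definition Psi_mul : @hom (EM G) (Phi_apex (etens (Psi_ob T) (Psi_ob S))) (apex S) :=
  @Build_CoalgebraHom _ _ (Phi_apex (etens (Psi_ob T) (Psi_ob S))) (apex S)
  (tl PB (forget_span T) (forget_span S)) Psi_mu_subproof1.

Definition Psi_mur : @hom (EM G) (Phi_apex (etens (Psi_ob T) (Psi_ob S))) (apex T) :=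
  @Build_CoalgebraHom _ _ (Phi_apex (etens (Psi_ob T) (Psi_ob S))) (apex T)
  (tr PB (forget_span T) (forget_span S)) Psi_mu_subproof2.

Lemma Psi_mu_subproof3 : rleg S ∘ Psi_mul = lleg T ∘ Psi_mur.
Proof. apply: cohom_eq; exact: (t_comm PB (forget_span T) (forget_span S)). Qed.

(** Goes the other way from [Phi_mu_span]: the projections in [E] are coalgebra morphisms, hence
    form a cone in [EM G]. *)
Definition Psi_mu_lift :
  @hom (EM G) (Phi_apex (etens (Psi_ob T) (Psi_ob S))) (apex (vtens T S)) :=
  tlift PB' Psi_mu_subproof3.

Lemma tl_Psi_mu_lift :
  cohom (tl PB' T S) ∘ cohom Psi_mu_lift = tl PB (forget_span T) (forget_span S).
Proof. exact: (f_equal (@cohom _ _ _ _) (tl_lift PB' Psi_mu_subproof3)). Qed.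

Lemma tr_Psi_mu_lift :
  cohom (tr PB' T S) ∘ cohom Psi_mu_lift = tr PB (forget_span T) (forget_span S).
Proof. exact: (f_equal (@cohom _ _ _ _) (tr_lift PB' Psi_mu_subproof3)). Qed.

Definition Psi_mu_span : hom (sp_tens PB (forget_span T) (forget_span S))
  (forget_span (vtens T S)).
Proof.
refine (@Build_SpanHom E X X'' (sp_tens PB (forget_span T) (forget_span S))
   (forget_span (vtens T S)) (cohom Psi_mu_lift) _ _).
- by rewrite lleg_tens -tl_Psi_mu_lift -comp_assoc.
- by rewrite rleg_tens -tr_Psi_mu_lift -comp_assoc.
Defined.

Definition Psi_mu : hom (etens (Psi_ob T) (Psi_ob S)) (Psi_ob (vtens T S)).
Proof.
refine (@EW_hom _ _ (etens (Psi_ob T) (Psi_ob S)) (Psi_ob (vtens T S)) Psi_mu_span _).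
apply: (eq_trans (f_equal (fun x => x ∘ _) (apex_act_Psi (vtens T S)))).
exact: (cohomP Psi_mu_lift).
Defined.

Lemma tl_Psi_mu :
  cohom (tl PB' T S) ∘ shm (cohom Psi_mu) = tl PB (forget_span T) (forget_span S).
Proof. exact: tl_Psi_mu_lift. Qed.

Lemma tr_Psi_mu :
  cohom (tr PB' T S) ∘ shm (cohom Psi_mu) = tr PB (forget_span T) (forget_span S).
Proof. exact: tr_Psi_mu_lift. Qed.
End PsiMu.
End Tens.

(** * Comparison constraints for identities *)

Section Eta.
Variable X : Coalgebra G.
Notation eid := (@emb_id _ (SpnComonad PB HG) X).

(** [geta] is induced by a cone whose middle leg is the coaction of [X]. *)
Lemma apex_act_id : apex_act eid = coact X.
Proof. exact: gS_geta. Qed.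

Definition Phi_eta : hom (@sp_id (EM G) X) (Phi_ob eid).
Proof.
refine (@EV_hom _ _ (@sp_id (EM G) X) (Phi_ob eid)
  (@Build_SpanHom E X X (forget_span (@sp_id (EM G) X)) (@sp_id E X) (idm (carrier X))
    (comp_idl _) (comp_idl _)) _).
apply: (eq_trans (f_equal (fun x => x ∘ _) apex_act_id)).
by rewrite /= comp_idr fmap_id comp_idl.
Defined.

Definition Psi_eta : hom eid (Psi_ob (@sp_id (EM G) X)).
Proof.
refine (@EW_hom _ _ eid (Psi_ob (@sp_id (EM G) X))
  (@Build_SpanHom E X X (@sp_id E X) (forget_span (@sp_id (EM G) X)) (idm (carrier X))
    (comp_idl _) (comp_idl _)) _).
by rewrite apex_act_id apex_act_Psi /= comp_idr fmap_id comp_idl.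
Defined.
End Eta.
End LocalComparison.

(** * The two morphisms of Caten and their composites *)

Section Equivalence.
Variables (E : Category) (PB : HasPullbacks E) (G : Comonad E)
  (HG : PreservesPullbacks G) (PB' : HasPullbacks (EM G)).
(** Test maps are arbitrary in [E], not coalgebra morphisms, so the universal property in [EM G]
    does not give this directly. *)
Hypothesis jointly_monic : forall (a b c : EM G) (f : hom a c) (g : hom b c) (x : E)
    (h k : hom x (carrier (pb (PB' f g)))),
     cohom (pbl (PB' f g)) ∘ h = cohom (pbl (PB' f g)) ∘ k ->
     cohom (pbr (PB' f g)) ∘ h = cohom (pbr (PB' f g)) ∘ k -> h = k.

Notation W := (EMBicat (SpnComonad PB HG)).
Notation V := (Spn PB').

Definition EMBicat_apex : SpanLike E W :=
  EMBicat_span_like (@Spn_span_like E E PB (IdFunctor E) (fun _ _ _ _ e => e)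
    (fun _ _ _ f g => @pb_eq E _ _ _ f g (PB f g))) (SpnComonad PB HG).

Definition Spn_EM_apex : SpanLike E V :=
  @Spn_span_like E (EM G) PB' (EM_forget G) (@cohom_eq E G) jointly_monic.

Notation K := EMBicat_apex.
Notation L := Spn_EM_apex.

(** W and V have the same objects, so the identity span of Ob W serves as the
    object span of morphisms in both directions. *)
Definition Phi_at (w w' : W) (v v' : V) (A : @IdOb W w v) (A' : @IdOb W w' v') :
  Functor (bhom w w') (bhom v v') :=
  match A in IdOb w v, A' in IdOb w' v' return Functor (@bhom W w w') (@bhom V v v') with
  | idob w, idob w' => Phi PB HG w w'
  end.

Definition Phi_at_mu (w w' w'' : W) (v v' v'' : V) (A : @IdOb W w v) (A' : @IdOb W w' v')
  (A'' : @IdOb W w'' v'') : forall (f' : bhom w' w'') (f : bhom w w'),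
  hom (Phi_at A' A'' f' ⊗ Phi_at A A' f) (Phi_at A A'' (f' ⊗ f)) :=
  match A in IdOb w v, A' in IdOb w' v', A'' in IdOb w'' v''
    return forall (f' : bhom w' w'') (f : bhom w w'),
      hom (@tens V v v' v'' (Phi_at A' A'' f') (Phi_at A A' f)) (Phi_at A A'' (f' ⊗ f)) with
  | idob _, idob _, idob _ => fun f' f => Phi_mu PB' f' f
  end.

Definition Phi_at_eta (w : W) (v : V) (A : @IdOb W w v) : hom (bid v) (Phi_at A A (bid w)) :=
  match A in IdOb w v return hom (@bid V v) (Phi_at A A (bid w)) with
  | idob w => Phi_eta PB HG w
  end.

(** [Phi] leaves apices unchanged in [E], so identities serve as frames. *)
Definition Phi_frame (w w' : W) (v v' : V) (A : @IdOb W w v) (A' : @IdOb W w' v') :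
  forall f : bhom w w', hom (ap L (Phi_at A A' f)) (ap K f) :=
  match A in IdOb w v, A' in IdOb w' v'
    return forall f : @bhom W w w', hom (ap L (Phi_at A A' f)) (ap K f) with
  | idob w, idob w' => fun f => idm (ap K f)
  end.

Lemma idm_mono (x : E) : Mono (idm x).
Proof. by move=> y h k; rewrite !comp_idl. Qed.

Lemma Phi_framed : framed Phi_at_mu Phi_frame.
Proof.
split; [|split; [|split]].
- by move=> w w' v v' [{}w] [{}w'] f; exact: idm_mono.
- move=> w w' v v' [{}w] [{}w'] f g a.
  exact: (eq_trans (comp_idl _) (eq_sym (comp_idr _))).
- move=> w w' w'' v v' v'' [{}w] [{}w'] [{}w''] f' f.
  exact: (eq_trans (f_equal (comp _) (comp_idl _))
    (eq_trans (tl_Phi_mu _ _ _) (eq_sym (comp_idl _)))).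
- move=> w w' w'' v v' v'' [{}w] [{}w'] [{}w''] f' f.
  exact: (eq_trans (f_equal (comp _) (comp_idl _))
    (eq_trans (tr_Phi_mu _ _ _) (eq_sym (comp_idl _)))).
Qed.

Definition Phi_mor : Morphism W V := framed_morphism Phi_at_eta Phi_framed.

Definition Psi_at (v v' : V) (w w' : W) (A : @IdOb W v w) (A' : @IdOb W v' w') :
  Functor (@bhom V v v') (@bhom W w w') :=
  match A in IdOb v w, A' in IdOb v' w' return Functor (@bhom V v v') (@bhom W w w') with
  | idob w, idob w' => Psi PB HG w w'
  end.

Definition Psi_at_mu (v v' v'' : V) (w w' w'' : W) (A : @IdOb W v w) (A' : @IdOb W v' w')
  (A'' : @IdOb W v'' w'') : forall (f' : @bhom V v' v'') (f : @bhom V v v'),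
  hom (@tens W w w' w'' (Psi_at A' A'' f') (Psi_at A A' f))
    (Psi_at A A'' (@tens V v v' v'' f' f)) :=
  match A in IdOb v w, A' in IdOb v' w', A'' in IdOb v'' w''
    return forall (f' : @bhom V v' v'') (f : @bhom V v v'),
      hom (@tens W w w' w'' (Psi_at A' A'' f') (Psi_at A A' f))
        (Psi_at A A'' (@tens V v v' v'' f' f)) with
  | idob _, idob _, idob _ => fun f' f => Psi_mu PB HG PB' f' f
  end.

Definition Psi_at_eta (v : V) (w : W) (A : @IdOb W v w) :
  hom (@bid W w) (Psi_at A A (@bid V v)) :=
  match A in IdOb v w return hom (@bid W w) (Psi_at A A (@bid V v)) with
  | idob w => Psi_eta PB HG w
  end.

Definition Psi_frame (v v' : V) (w w' : W) (A : @IdOb W v w) (A' : @IdOb W v' w') :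
  forall f : @bhom V v v', hom (ap K (Psi_at A A' f)) (ap L f) :=
  match A in IdOb v w, A' in IdOb v' w'
    return forall f : @bhom V v v', hom (ap K (Psi_at A A' f)) (ap L f) with
  | idob w, idob w' => fun f => idm (ap L f)
  end.

Lemma Psi_framed : framed (W := V) (V := W) Psi_at_mu Psi_frame.
Proof.
split; [|split; [|split]].
- by move=> w w' v v' [{}w] [{}w'] f; exact: idm_mono.
- move=> w w' v v' [{}w] [{}w'] f g a.
  exact: (eq_trans (comp_idl _) (eq_sym (comp_idr _))).
- move=> w w' w'' v v' v'' [{}w] [{}w'] [{}w''] f' f.
  exact: (eq_trans (f_equal (comp _) (comp_idl _))
    (eq_trans (tl_Psi_mu _ _ _ _ _) (eq_sym (comp_idl _)))).
- move=> w w' w'' v v' v'' [{}w] [{}w'] [{}w''] f' f.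
  exact: (eq_trans (f_equal (comp _) (comp_idl _))
    (eq_trans (tr_Psi_mu _ _ _ _ _) (eq_sym (comp_idl _)))).
Qed.

Definition Psi_mor : Morphism V W := framed_morphism Psi_at_eta Psi_framed.

Notation PsiPhi := (CompMorphism Psi_mor Phi_mor).
Notation PhiPsi := (CompMorphism Phi_mor Psi_mor).

Lemma Phi_mor_framed : framed (@mmu W V Phi_mor) Phi_frame.
Proof. exact: Phi_framed. Qed.

Lemma Psi_mor_framed : framed (@mmu V W Psi_mor) Psi_frame.
Proof. exact: Psi_framed. Qed.

(** An object of the composite carries a middle object and two fibre elements; eliminating the
    second transports the first, which is the result. *)
Definition PsiPhi_ob (w w' : W) (X : mob PsiPhi w w') : mob (IdMorphism W) w w' :=
  match X with
  | existT _ v (x, y) => (match y in IdOb v w' return @IdOb W w v -> @IdOb W w w' with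
     | idob _ => fun x => x end) x
  end.

Definition PsiPhi_ob_inv (w w' : W) (X : mob (IdMorphism W) w w') : mob PsiPhi w w' :=
  match X in IdOb w w' return mob PsiPhi w w' with
  | idob w => existT (fun v : V => (@IdOb W w v * @IdOb W v w)%type) w (idob w, idob w)
  end.

Lemma PsiPhi_obK w w' (X : mob PsiPhi w w') : PsiPhi_ob_inv (PsiPhi_ob X) = X.
Proof. by case: X => v [x y]; case: y x => {}v x; case: x => {}w. Qed.

Lemma PsiPhi_ob_invK w w' (X : mob (IdMorphism W) w w') : PsiPhi_ob (PsiPhi_ob_inv X) = X.
Proof. by case: X. Qed.

Definition PsiPhi_hom (w w' v v' : W) (X : mob PsiPhi w v) (X' : mob PsiPhi w' v')
  (f : @bhom W w w') :
  hom (mhom PsiPhi X X' f) (mhom (IdMorphism W) (PsiPhi_ob X) (PsiPhi_ob X') f).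
Proof.
case: X X' => u [x y] [u' [x' y']].
(* [x] is generalised along with [y], and [f] along with [x], since their types mention the object
   being eliminated. *)
case: y x => {}u x; case: x f => {}u.
case: y' x' => {}u' x'; case: x' => {}u' f.
exact: (Psi_Phi_iso f).
Defined.

Definition PsiPhi_hom_inv (w w' v v' : W) (X : mob (IdMorphism W) w v)
  (X' : mob (IdMorphism W) w' v') (f : @bhom W w w') :
  hom (mhom (IdMorphism W) X X' f) (mhom PsiPhi (PsiPhi_ob_inv X) (PsiPhi_ob_inv X') f).
Proof.
case: X f => {}w f; case: X' f => {}w' f; exact: (Psi_Phi_iso_inv f).
Defined.

Lemma PsiPhi_framed : framed (@mmu _ _ PsiPhi)
  (@comp_frame E W V W K L K Phi_mor Psi_mor Phi_frame Psi_frame).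
Proof.
apply: (@comp_framed E W V W K L K Phi_mor Psi_mor);
  [exact: Phi_mor_framed | exact: Psi_mor_framed].
Qed.

(** Every 2-cell involved has an identity apex, so after elimination of the fibre elements the frame
    conditions only compose identities. *)
Lemma PsiPhi_equiv : EquivalentMorphisms PsiPhi (IdMorphism W).
Proof.
refine (@framed_equivalent E W W _ _ PsiPhi (IdMorphism W) _ _ PsiPhi_framed (@id_framed E W K)
  PsiPhi_ob PsiPhi_ob_inv PsiPhi_hom PsiPhi_hom_inv _ _ _ _ _).
- move=> w w' v v' [u [x y]] [u' [x' y']].
  case: y x => {}u x; case: x => {}u.
  case: y' x' => {}u' x'; case: x' => {}u' f.
  by change (idm (apex (carrier f)) ∘ idm _ = idm (apex (carrier f)) ∘ idm _).
- move=> w w' v v' [{}w] [{}w'] f.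
  change ((idm (apex (carrier f)) ∘ idm (apex (carrier f))) ∘ idm (apex (carrier f))
    = idm (apex (carrier f))).
  by rewrite !comp_idl.
- move=> w v [u [x y]]; case: y x => {}u x; case: x => {}u.
  change ((idm (carrier u) ∘ idm (carrier u)) ∘ idm (carrier u) ∘ idm (carrier u)
    = idm (carrier u) ∘ idm (carrier u)).
  by rewrite !comp_idl.
- exact: PsiPhi_obK.
- exact: PsiPhi_ob_invK.
Qed.

(** The inner match rebuilds the element over [V]: [IdOb] over [W] and over [V] are distinct types,
    although the objects coincide. *)
Definition PhiPsi_ob (w w' : V) (X : mob PhiPsi w w') : mob (IdMorphism V) w w' :=
  match X with
  | existT _ v (x, y) => (match y in IdOb v w' return @IdOb W w v -> @IdOb V w w' with
     | idob _ => fun x => match x in IdOb w v return @IdOb V w v with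
         | idob w => @idob V w end end) x
  end.

Definition PhiPsi_ob_inv (w w' : V) (X : mob (IdMorphism V) w w') : mob PhiPsi w w' :=
  match X in IdOb w w' return mob PhiPsi w w' with
  | idob w => existT (fun v : W => (@IdOb W w v * @IdOb W v w)%type) w (@idob W w, @idob W w)
  end.

Lemma PhiPsi_obK w w' (X : mob PhiPsi w w') : PhiPsi_ob_inv (PhiPsi_ob X) = X.
Proof. by case: X => v [x y]; case: y x => {}v x; case: x => {}w. Qed.

Lemma PhiPsi_ob_invK w w' (X : mob (IdMorphism V) w w') : PhiPsi_ob (PhiPsi_ob_inv X) = X.
Proof. by case: X. Qed.

Definition PhiPsi_hom (w w' v v' : V) (X : mob PhiPsi w v) (X' : mob PhiPsi w' v')
  (f : @bhom V w w') :
  hom (mhom PhiPsi X X' f) (mhom (IdMorphism V) (PhiPsi_ob X) (PhiPsi_ob X') f).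
Proof.
case: X X' => u [x y] [u' [x' y']].
case: y x => {}u x; case: x f => {}u.
case: y' x' => {}u' x'; case: x' => {}u' f.
exact: (Phi_Psi_iso PB HG f).
Defined.

Definition PhiPsi_hom_inv (w w' v v' : V) (X : mob (IdMorphism V) w v)
  (X' : mob (IdMorphism V) w' v') (f : @bhom V w w') :
  hom (mhom (IdMorphism V) X X' f) (mhom PhiPsi (PhiPsi_ob_inv X) (PhiPsi_ob_inv X') f).
Proof.
case: X f => {}w f; case: X' f => {}w' f; exact: (Phi_Psi_iso_inv PB HG f).
Defined.

Lemma PhiPsi_framed : framed (@mmu _ _ PhiPsi)
  (@comp_frame E V W V L K L Psi_mor Phi_mor Psi_frame Phi_frame).
Proof.
apply: (@comp_framed E V W V L K L Psi_mor Phi_mor);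
  [exact: Psi_mor_framed | exact: Phi_mor_framed].
Qed.

Lemma PhiPsi_equiv : EquivalentMorphisms PhiPsi (IdMorphism V).
Proof.
refine (@framed_equivalent E V V _ _ PhiPsi (IdMorphism V) _ _ PhiPsi_framed (@id_framed E V L)
  PhiPsi_ob PhiPsi_ob_inv PhiPsi_hom PhiPsi_hom_inv _ _ _ _ _).
- move=> w w' v v' [u [x y]] [u' [x' y']].
  case: y x => {}u x; case: x => {}u.
  case: y' x' => {}u' x'; case: x' => {}u' f.
  by change (idm (carrier (apex f)) ∘ idm _ = idm (carrier (apex f)) ∘ idm _).
- move=> w w' v v' [{}w] [{}w'] f.
  change ((idm (carrier (apex f)) ∘ idm (carrier (apex f))) ∘ idm (carrier (apex f))
    = idm (carrier (apex f))).
  by rewrite !comp_idl.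
- move=> w v [u [x y]]; case: y x => {}u x; case: x => {}u.
  change ((idm (carrier u) ∘ idm (carrier u)) ∘ idm (carrier u) ∘ idm (carrier u)
    = idm (carrier u) ∘ idm (carrier u)).
  by rewrite !comp_idl.
- exact: PhiPsi_obK.
- exact: PhiPsi_ob_invK.
Qed.
End Equivalence.

Theorem proposition4p4 (E : Category) (PB : HasPullbacks E) (G : Comonad E)
  (HG : PreservesPullbacks G) :
  CatenEquivalent (EMBicat (SpnComonad PB HG)) (Spn (EM_pullbacks PB HG)).
Proof.
(* These pullbacks of coalgebras were built on pullbacks in [E], with the same projections, so joint
   monicity holds against all maps of [E]. *)
have jointly_monic (a b c : EM G) (f : hom a c) (g : hom b c) (x : E)
    (h k : hom x (carrier (pb (EM_pullbacks PB HG f g)))) :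
     cohom (pbl (EM_pullbacks PB HG f g)) ∘ h = cohom (pbl (EM_pullbacks PB HG f g)) ∘ k ->
     cohom (pbr (EM_pullbacks PB HG f g)) ∘ h = cohom (pbr (EM_pullbacks PB HG f g)) ∘ k ->
     h = k by exact: (@pb_eq E _ _ _ _ _ (PB _ _ _ (cohom f) (cohom g))).
exists (Phi_mor PB HG jointly_monic), (Psi_mor PB HG jointly_monic);
  split; [exact: PsiPhi_equiv | exact: PhiPsi_equiv].
Qed.
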